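(* Any element of the form $$\overline f=\varphi_0(q)+\sum_{s\ge0}\big(V^{s+1}(\varphi_{p^s}(q))\big)\left(\frac{q'}{q^p}\right)^{p^s}\in k((q))[q']$$ with $\varphi_0(q),\varphi_1(q),\varphi_p(q),\varphi_{p^2}(q),\dots\in k((q))$ (all but finitely many of the $\varphi_{p^s}$ being zero) is Laurent $\delta$-$p$-symmetric, and $$\text{''}pU\text{''}\,\overline f=-\sum_{s\ge0}V^s(\varphi^{(-1)}_{p^s}(q))+\sum_{s\ge0}\big(V^{s+1}(U(\varphi_{p^s}(q)))\big)\left(\frac{q'}{q^p}\right)^{p^s}.$$ If in addition $\overline f\in k[[q]][q']$ (i.e. if $\varphi_0(q)\in k[[q]]$ and $\varphi_1(q),\varphi_p(q),\varphi_{p^2}(q),\dots\in qk[[q]]$), then $\overline f$ is Taylor $\delta$-$p$-symmetric.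
   Context: $p\ge5$ is a prime and $k$ is an algebraic closure of $\mathbb F_p$. On $k((q))$: $V(\sum a_mq^m)=\sum a_mq^{pm}$, $U(\sum a_mq^m)=\sum a_{mp}q^m$, and for $\varphi=\sum a_nq^n$, $\varphi^{(-1)}:=\theta^{p-2}\varphi=\sum_{(n,p)=1}\frac{a_n}{n}q^n$, where $\theta=q\frac{d}{dq}$. For $j=1,\dots,p$ let $S_j\in\mathbb Z[q_1,\dots,q_p]$ be the $j$-th elementary symmetric polynomial and put $\delta S_j=\frac1p\big(S_j(q_1^p+pq_1',\dots,q_p^p+pq_p')-S_j(q_1,\dots,q_p)^p\big)\in\mathbb Z[q_1,\dots,q_p,q'_1,\dots,q'_p]$. The $k$-algebra maps $$k[[s_1,\dots,s_p]][s'_1,\dots,s'_p]\to k[[q_1,\dots,q_p]][q'_1,\dots,q'_p],$$ $$k[[s_1,\dots,s_p]][s_p^{-1}][s'_1,\dots,s'_p]\to k[[q_1,\dots,q_p]][q_1^{-1}\cdots q_p^{-1}][q'_1,\dots,q'_p]$$ given by $s_j\mapsto S_j$, $s'_j\mapsto\delta S_j$ (reduced mod $p$) are injective. An element $\overline f\in k[[q]][q']$ (respectively $\overline f\in k((q))[q']$) is called Taylor (respectively Laurent) $\delta$-$p$-symmetric if $\Sigma_p\overline f:=\sum_{j=1}^p\overline f(q_j,q_j')$ lies in the image of the first (respectively second) map; the unique preimage is denoted $(\Sigma_p\overline f)_{(p)}$. For such $\overline f$, ''$pU$''$\overline f$ is the series in $q,q'$ obtained from $(\Sigma_p\overline f)_{(p)}$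 by setting $s_1=\dots=s_{p-1}=0$, $s_p=q$, $s'_1=\dots=s'_{p-1}=0$, $s'_p=q'$. *)

(* Defs.v *)
From HB Require Import structures.
From mathcomp Require Import all_boot all_order all_algebra.
From mathcomp Require Import boolp classical_sets functions cardinality fsbigop.
From mathcomp Require Import mpoly.
From mathcomp Require Import zify.

Set Implicit Arguments.
Unset Strict Implicit.
Unset Printing Implicit Defensive.

Import Order.TTheory GRing.Theory Num.Theory.
Local Open Scope ring_scope.

Definition lower_bounded (R : nmodType) n (c : {ffun 'I_n -> int} -> R) : Prop :=
  exists N : nat, forall d, c d != 0 -> forall i, - N%:Z <= d i.

(* R[[x_1, ..., x_n]][1/(x_1 ... x_n)]: a family of coefficients indexed by
   Z^n is such a series exactly when the exponents in its support are bounded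
   below.  For n = 1 this is R((x)). *)
Record mlaurent (R : nmodType) (n : nat) := MLaurent {
  lcoef :> {ffun 'I_n -> int} -> R;
  _ : `[< lower_bounded lcoef >] }.

HB.instance Definition _ (R : nmodType) n := [isSub for @lcoef R n].
HB.instance Definition _ (R : nmodType) n := [Choice of mlaurent R n by <:].

Lemma lcoef_bounded (R : nmodType) n (f : mlaurent R n) : lower_bounded f.
Proof. by case: f => c /= /asboolP. Qed.

Lemma mlaurent_eq (R : nmodType) n (f g : mlaurent R n) :
  (forall d, f d = g d) -> f = g.
Proof. by move=> fg; apply/val_inj/funext. Qed.

Section Zmod.
Variables (R : zmodType) (n : nat).
Implicit Types f g : mlaurent R n.

Lemma lzero_bounded : `[< lower_bounded (fun _ : {ffun 'I_n -> int} => 0 : R) >].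
Proof. by apply/asboolP; exists 0%N => d; rewrite eqxx. Qed.

Lemma ladd_bounded f g : `[< lower_bounded (fun d => f d + g d) >].
Proof.
apply/asboolP; have [N hN] := lcoef_bounded f; have [M hM] := lcoef_bounded g.
exists (N + M)%N => d.
have [->|/hN h _] := eqVneq (f d) 0.
  rewrite add0r => /hM h i; apply: le_trans (h i).
  by rewrite lerN2 lez_nat leq_addl.
by move=> i; apply: le_trans (h i); rewrite lerN2 lez_nat leq_addr.
Qed.

Lemma lopp_bounded f : `[< lower_bounded (fun d => - f d) >].
Proof.
apply/asboolP; have [N hN] := lcoef_bounded f; exists N => d.
by rewrite oppr_eq0 => /hN.
Qed.

Definition lzero := MLaurent lzero_bounded.
Definition ladd f g := MLaurent (ladd_bounded f g).
Definition lopp f := MLaurent (lopp_bounded f).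

Lemma laddA : associative ladd.
Proof. by move=> f g h; apply: mlaurent_eq => d /=; rewrite addrA. Qed.
Lemma laddC : commutative ladd.
Proof. by move=> f g; apply: mlaurent_eq => d /=; rewrite addrC. Qed.
Lemma ladd0 : left_id lzero ladd.
Proof. by move=> f; apply: mlaurent_eq => d /=; rewrite add0r. Qed.
Lemma laddN : left_inverse lzero lopp ladd.
Proof. by move=> f; apply: mlaurent_eq => d /=; rewrite addNr. Qed.

HB.instance Definition _ :=
  GRing.isZmodule.Build (mlaurent R n) laddA laddC ladd0 laddN.

(* The series with the given coefficients; 0 if they do not form a series. *)
Definition mklaurent (c : {ffun 'I_n -> int} -> R) : mlaurent R n :=
  insubd (0 : mlaurent R n) c.

Lemma mklaurentE c : lower_bounded c -> mklaurent c =1 c.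
Proof.
by move=> hc d; rewrite /mklaurent -[lcoef _]/(val _) insubdK //; apply/asboolP.
Qed.

End Zmod.

Lemma conv_range (x y : int) (a b c m : nat) : (a + b + c <= m)%N ->
  - c%:Z <= x <= c%:Z -> - b%:Z <= x - y -> - a%:Z <= y -> - m%:Z <= y <= m%:Z.
Proof. lia. Qed.

Lemma conv_lower (x y : int) (a b : nat) :
  - b%:Z <= x - y -> - a%:Z <= y -> - (a + b)%N%:Z <= x.
Proof. lia. Qed.

Lemma conv_range3 (x y z : int) (a b c d m : nat) : (a + b + c + d <= m)%N ->
  - d%:Z <= x <= d%:Z -> - c%:Z <= x - y -> - b%:Z <= y - z -> - a%:Z <= z ->
  - m%:Z <= y <= m%:Z.
Proof. lia. Qed.

Section Box.
Variable n : nat.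
Local Notation E := {ffun 'I_n -> int}.

Definition box (M : nat) : seq E :=
  [seq [ffun i => (val (t i))%:Z - M%:Z] | t : {ffun 'I_n -> 'I_(M + M).+1}].

Lemma box_uniq M : uniq (box M).
Proof.
apply/injectiveP => t u /ffunP tu; apply/ffunP => i.
by have := tu i; rewrite !ffunE => /addIr [] /val_inj.
Qed.

Lemma mem_box M (a : E) : (a \in box M) = [forall i, `|a i| <= M%:Z].
Proof.
apply/fintype.imageP/forallP => [[t _ ->] i|h].
  rewrite ffunE; have := ltn_ord (t i); rewrite ltnS => ht.
  rewrite ler_norml lerBlDr -PoszD lez_nat ht andbT.
  by rewrite lerBrDr addNr.
exists [ffun i => inord (absz (a i + M%:Z))] => //.
apply/ffunP => i; rewrite !ffunE; have := h i; rewrite ler_norml => /andP[h1 h2].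
have h3 : 0 <= a i + M%:Z by rewrite -lerBlDr sub0r.
rewrite /= inordK; first by rewrite gez0_abs // addrK.
by rewrite ltnS -lez_nat gez0_abs // PoszD lerD2r.
Qed.

Lemma fsum_box (R : nmodType) (F : E -> R) M :
    (forall a, F a != 0 -> forall i, `|a i| <= M%:Z) ->
  \sum_(a \in [set: E]) F a = \sum_(a <- box M) F a.
Proof.
move=> h; rewrite (@fsbigE _ _ _ _ _ (box M)) ?box_uniq //.
  by apply: eq_bigl => a; rewrite in_setT.
by move=> a _; apply: contraNeq => /h ha; rewrite mem_box; apply/forallP.
Qed.
End Box.

Section Ring.
Variables (R : comNzRingType) (n : nat).
Local Notation E := {ffun 'I_n -> int}.
Implicit Types f g h : mlaurent R n.

Definition lmul f g : mlaurent R n :=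
  mklaurent (fun d => \sum_(a \in [set: E]) f a * g (d - a)).

Definition ebound (d : E) : nat := \max_i absz (d i).

Lemma eboundP (d : E) i : `|d i| <= (ebound d)%:Z.
Proof. by rewrite -abszE lez_nat /ebound (leq_bigmax (F := fun i => absz (d i))). Qed.

Definition lbnd f : nat := xget 0%N
  [set N : nat | forall d, f d != 0 -> forall i, - N%:Z <= d i].

Lemma lbndP f d : f d != 0 -> forall i, - (lbnd f)%:Z <= d i.
Proof. by have := xgetPex 0%N (lcoef_bounded f) => /(_ d). Qed.

Lemma lmul_sum_box f g d M : (lbnd f + lbnd g + ebound d <= M)%N ->
  \sum_(a \in [set: E]) f a * g (d - a) = \sum_(a <- box n M) f a * g (d - a).
Proof.
move=> hM; apply: fsum_box => a h i.
have fa : f a != 0 by apply: contraNneq h => ->; rewrite mul0r.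
have ga : g (d - a) != 0 by apply: contraNneq h => ->; rewrite mulr0.
have := lbndP fa i; have := lbndP ga i; have := eboundP d i.
rewrite !ffunE !ler_norml => h1 h2 h3; apply: conv_range hM h1 h2 h3.
Qed.

Lemma lmulE f g d : lmul f g d = \sum_(a \in [set: E]) f a * g (d - a).
Proof.
rewrite mklaurentE //; exists (lbnd f + lbnd g)%N => {}d.
move=> h i; rewrite leNgt; apply: contraNN h => h; apply/eqP.
rewrite fsbig1 // => a _; apply/eqP; apply: contraLR h => h.
have fa : f a != 0 by apply: contraNneq h => ->; rewrite mul0r.
have ga : g (d - a) != 0 by apply: contraNneq h => ->; rewrite mulr0.
have := lbndP fa i; have := lbndP ga i; rewrite !ffunE -leNgt => h1 h2; apply: conv_lower h1 h2.
Qed.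

Lemma lmul_box f g d M : (lbnd f + lbnd g + ebound d <= M)%N ->
  lmul f g d = \sum_(a <- box n M) f a * g (d - a).
Proof. by move=> h; rewrite lmulE; apply: lmul_sum_box. Qed.

Lemma lmulC : commutative lmul.
Proof.
move=> f g; apply: mlaurent_eq => d; rewrite !lmulE.
rewrite (@reindex_fsbigT _ _ _ _ _ (fun a : E => d - a)); last first.
  by exists (fun a : E => d - a) => a; rewrite subKr.
by apply: eq_fsbigr => a _; rewrite subKr mulrC.
Qed.

Lemma lmulDl : left_distributive lmul (@ladd R n).
Proof.
move=> f g h; apply: mlaurent_eq => d.
pose M := (lbnd (ladd f g) + lbnd f + lbnd g + lbnd h + ebound d)%N.
rewrite /= !(@lmul_box _ _ _ M) ?/M; try lia.
by rewrite -big_split; apply: eq_bigr => a _; rewrite /= mulrDl.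
Qed.

Definition lmono_fun (a d : E) : R := (d == a)%:R.

Lemma lmono_bounded a : `[< lower_bounded (lmono_fun a) >].
Proof.
apply/asboolP; exists (ebound a) => d; rewrite /lmono_fun.
have [-> _ i|_] := eqVneq d a; last by rewrite eqxx.
by have := eboundP a i; rewrite ler_norml => /andP[].
Qed.

(* the monomial x^a, for a in Z^n *)
Definition lmono a := MLaurent (lmono_bounded a).

Lemma lmul_monol a f d : lmul (lmono a) f d = f (d - a).
Proof.
rewrite lmulE (fsbigE [:: a]) ?big_cons ?big_nil //.
  by rewrite in_setT /= addr0 /lmono_fun eqxx mul1r.
by move=> b _; rewrite inE /= /lmono_fun => /negbTE ->; rewrite mul0r.
Qed.

Lemma lmul1 : left_id (lmono 0) lmul.
Proof. by move=> f; apply: mlaurent_eq => d; rewrite lmul_monol subr0. Qed.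

Lemma lone_neq0 : lmono 0 != 0.
Proof.
apply/eqP => /(congr1 (fun f : mlaurent R n => f 0)) /=.
by rewrite /lmono_fun eqxx => /eqP; rewrite oner_eq0.
Qed.

Lemma lmulA : associative lmul.
Proof.
move=> f g h; apply: mlaurent_eq => d.
pose N := (lbnd f + lbnd g + lbnd h + lbnd (lmul f g) + lbnd (lmul g h))%N.
pose M := (ebound d + N + N)%N; pose M' := (M + N + N)%N.
rewrite (@lmul_box f _ _ M'); last by rewrite /M' /M /N; lia.
rewrite (@lmul_box _ h _ M); last by rewrite /M /N; lia.
under [RHS]eq_big_seq => b.
  rewrite mem_box => /forallP hb.
  have le_b : (ebound b <= M)%N.
    by apply/bigmax_leqP => i _; have := hb i; rewrite -abszE lez_nat.
  rewrite (@lmul_box _ _ _ M'); last by rewrite /M' /N; lia.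
  rewrite mulr_suml; over.
rewrite exchange_big; apply: eq_bigr => a _.
have [->|fa] := eqVneq (f a) 0.
  by rewrite mul0r big1 // => b _; rewrite !mul0r.
under [RHS]eq_bigr do rewrite -mulrA.
rewrite -mulr_sumr; congr (_ * _); rewrite lmulE.
rewrite (@reindex_fsbigT _ _ _ _ _ (fun b : E => b - a)); last first.
  by exists (fun b : E => b + a) => b /=; rewrite ?subrK ?addrK.
under eq_fsbigr do rewrite opprB addrA subrK.
apply: fsum_box => b hb i.
have gb : g (b - a) != 0 by apply: contraNneq hb => ->; rewrite mul0r.
have hd : h (d - b) != 0.
  by apply: contraNneq hb => ->; rewrite mulr0.
have := lbndP fa i; have := lbndP gb i; have := lbndP hd i; have := eboundP d i.
rewrite !ffunE !ler_norml => h1 h2 h3 h4; apply: conv_range3 h1 h2 h3 h4.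
rewrite /M /N; lia.
Qed.

HB.instance Definition _ := GRing.Zmodule_isComNzRing.Build (mlaurent R n)
  lmulA lmulC lmul1 lmulDl lone_neq0.

Definition lunit : {pred mlaurent R n} :=
  fun f => `[< exists g : mlaurent R n, g * f = 1 >].
Definition linv f : mlaurent R n :=
  xget f [set g : mlaurent R n | g * f = 1].

Lemma linvV : {in lunit, left_inverse 1 linv *%R}.
Proof. by move=> f /asboolP ex; apply: (xgetPex f ex). Qed.
Lemma lunitP f g : g * f = 1 -> lunit f.
Proof. by move=> gf; apply/asboolP; exists g. Qed.
Lemma linv_out : {in [predC lunit], linv =1 id}.
Proof.
move=> f; rewrite inE => /asboolP nex.
by rewrite /linv; case: xgetP => // g _ gf; case: nex; exists g.
Qed.

HB.instance Definition _ := GRing.ComNzRing_hasMulInverse.Build (mlaurent R n)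
  linvV lunitP linv_out.

Definition lvar (i : 'I_n) : mlaurent R n := lmono [ffun j => (j == i)%:Z].

Definition powser : {pred mlaurent R n} :=
  fun f => `[< forall d, f d != 0 -> forall i, 0 <= d i >].

(* R[[x_1, ..., x_n]][1/x_n] *)
Definition powser_last : {pred mlaurent R n} :=
  fun f => `[< forall d, f d != 0 ->
                 forall i : 'I_n, i.+1 != n -> 0 <= d i >].

End Ring.

Arguments powser {R n}.
Arguments powser_last {R n}.

(* The substitution x_i := g_i, i.e. the sum of the F_e g^e, computed
   coefficientwise; \sum_(e \in _) is the sum of a finitely supported family.
   It is used below only where, for each exponent d, finitely many e contribute
   to the coefficient of index d:
   - g_i a variable;
   - F in R[[s_1, ..., s_p]][1/s_p] and g_i the elementary symmetric polynomial
     of degree i, by homogeneity (that of degree p is a monomial, so a unit);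
   - F in R[[s_1, ..., s_p]][1/s_p], g_p a variable and g_i = 0 for i < p. *)
Definition lsubst (R : comNzRingType) m n (g : 'I_m -> mlaurent R n)
    (F : mlaurent R m) : mlaurent R n :=
  mklaurent (fun d => \sum_(e \in [set: {ffun 'I_m -> int}])
                        F e * (\prod_(i < m) g i ^ e i) d).

Section OneVariable.
Variables (R : comNzRingType) (p : nat).
Local Notation L := (mlaurent R 1).
Implicit Types f : L.

Definition lX : L := lvar R ord0.

Definition lV f : L := mklaurent (fun d =>
  if (p%:Z %| d ord0)%Z then f [ffun=> (d ord0 %/ p%:Z)%Z] else 0).

Definition lU f : L := mklaurent (fun d => f [ffun=> d ord0 * p%:Z]).

Definition ltheta f : L := mklaurent (fun d => (d ord0)%:~R * f d).

(* the series denoted f^(-1) *)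
Definition lprim f : L := iter (p - 2) ltheta f.

Lemma lVE f m : (0 < p)%N -> lV f [ffun=> m] =
  if (p%:Z %| m)%Z then f [ffun=> (m %/ p%:Z)%Z] else 0.
Proof.
move=> p_gt0; rewrite mklaurentE ?ffunE //; have [N hN] := lcoef_bounded f.
exists (N * p)%N => d; case: ifP; last by rewrite eqxx.
move=> /divzK pd /hN /(_ ord0); rewrite ffunE => h i.
by rewrite (ord1 i) -pd PoszM -mulNr ler_wpM2r.
Qed.

Lemma lUE f m : (0 < p)%N -> lU f [ffun=> m] = f [ffun=> m * p%:Z].
Proof.
move=> p_gt0; rewrite mklaurentE ?ffunE //; have [N hN] := lcoef_bounded f.
exists N => d /hN /(_ ord0); rewrite ffunE => h i; rewrite (ord1 i).
have [d0|d0] := leP 0 (d ord0); first by apply: le_trans d0; rewrite oppr_le0.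
apply: le_trans h _; rewrite -[leRHS]mulr1 ler_wnM2l //; exact: ltW.
Qed.

Lemma lthetaE f m : ltheta f [ffun=> m] = m%:~R * f [ffun=> m].
Proof.
rewrite mklaurentE ?ffunE //; have [N hN] := lcoef_bounded f.
by exists N => d h; apply: hN; apply: contraNneq h => ->; rewrite mulr0.
Qed.

End OneVariable.

Section DeltaSymmetric.
Variable p : nat.

(* S_(j+1)(q_1^p + p q_1', ...) - S_(j+1)(q_1, ...)^p; the first p variables
   are the q_i, the last p ones are the q_i' *)
Definition pdeltaS (j : 'I_p) : {mpoly int[p + p]} :=
  (mesym p int j.+1 \mPo
     [tuple 'X_(lshift p i) ^+ p + 'X_(rshift p i) *+ p | i < p])
  - (mesym p int j.+1 \mPo [tuple 'X_(lshift p i) | i < p]) ^+ p.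

Definition int_deltaS (j : 'I_p) : {mpoly int[p + p]} :=
  \sum_(m <- msupp (pdeltaS j)) ((pdeltaS j)@_m %/ p%:Z)%Z *: 'X_[m].

Lemma comp_mesym (n m j : nat) (t : n.-tuple {mpoly int[m]}) :
  mesym n int j \mPo t =
  \sum_(h : {set 'I_n} | #|h| == j) \prod_(i in h) tnth t i.
Proof.
rewrite mesymE rmorph_sum; apply: eq_bigr => h _ /=; rewrite comp_mpolyX.
rewrite [RHS]big_mkcond; apply: eq_bigr => i _.
by rewrite mnmE; case: (i \in h); rewrite ?expr1 ?expr0.
Qed.

(* the division by p is exact *)
Lemma int_deltaSE (j : 'I_p) : prime p -> int_deltaS j *+ p = pdeltaS j.
Proof.
move=> p_pr; rewrite [RHS]mpolyE /int_deltaS -sumrMnl; apply: eq_bigr => m _.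
rewrite scalerMnl; congr (_ *: _).
rewrite -mulr_natr natz divzK //.
have pF : p \in [pchar 'F_p] by apply: pchar_Fp.
have pP : p \in [pchar {mpoly 'F_p[p + p]}].
  rewrite inE p_pr; apply/eqP.
  by rewrite -(rmorph_nat (@mpolyC (p + p) 'F_p)) (pcharf0 pF) rmorph0.
pose phi : {rmorphism {mpoly int[p + p]} -> {mpoly 'F_p[p + p]}} :=
  map_mpoly (intr : int -> 'F_p).
suff : phi (pdeltaS j) = 0.
  move=> /(congr1 (mcoeff m)); rewrite mcoeff_map_mpoly mcoeff0 /= => /eqP.
  case: (_@_m) => a; rewrite dvdzE /= (dvdn_pcharf pF) //.
  by rewrite NegzE rmorphN oppr_eq0.
rewrite /pdeltaS rmorphB rmorphXn !comp_mesym -(pFrobenius_autE pP).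
rewrite !(rmorph_sum phi) (rmorph_sum (pFrobenius_aut pP)) -sumrB.
rewrite big1 // => h _.
rewrite !(rmorph_prod phi) (rmorph_prod (pFrobenius_aut pP)); apply/eqP; rewrite subr_eq0; apply/eqP.
apply: eq_bigr => i _; rewrite !tnth_mktuple rmorphD rmorphMn rmorphXn /=.
by rewrite -mulr_natr (pcharf0 pP) mulr0 addr0 pFrobenius_autE.
Qed.

Variable k : comNzRingType.

(* the reduction mod p of delta S_(j+1) *)
Definition deltaS (j : 'I_p) : {mpoly (mlaurent k p)[p]} :=
  mmap (fun c : int => c%:~R)
       (fun i => match fintype.split i with
                 | inl a => (lvar k a)%:MP
                 | inr b => 'X_b
                 end)
       (int_deltaS j).

Definition lesym (j : 'I_p) : mlaurent k p :=
  mmap (fun c : int => c%:~R) (@lvar k p) (mesym p int j.+1).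

(* s_j |-> S_j, s_j' |-> delta S_j *)
Definition sym_map (F : {mpoly (mlaurent k p)[p]}) : {mpoly (mlaurent k p)[p]} :=
  mmap (fun c => (lsubst lesym c)%:MP) deltaS F.

Definition Sigma (f : {poly mlaurent k 1}) : {mpoly (mlaurent k p)[p]} :=
  \sum_(j < p) (map_poly (fun c => (lsubst (fun=> lvar k j) c)%:MP) f).['X_j].

Definition taylor_sym (f : {poly mlaurent k 1}) : Prop :=
  f \is a polyOver powser /\
  exists2 F, F \is a mpolyOver p powser & sym_map F = Sigma f.

Definition laurent_sym (f : {poly mlaurent k 1}) : Prop :=
  exists2 F, F \is a mpolyOver p powser_last & sym_map F = Sigma f.

(* (Sigma_p f)_(p); [xget 0] picks an element of a nonempty set *)
Definition Sigma_preim (f : {poly mlaurent k 1}) : {mpoly (mlaurent k p)[p]} :=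
  xget 0 [set F | F \is a mpolyOver p powser_last /\ sym_map F = Sigma f].

(* s_1 = ... = s_(p-1) = 0, s_p = q, s'_1 = ... = s'_(p-1) = 0, s'_p = q' *)
Definition specialize (F : {mpoly (mlaurent k p)[p]}) : {poly mlaurent k 1} :=
  mmap (fun c => (lsubst (fun i : 'I_p => if i.+1 == p then lX k else 0) c)%:P)
       (fun i : 'I_p => if i.+1 == p then 'X else 0) F.

Definition pU (f : {poly mlaurent k 1}) : {poly mlaurent k 1} :=
  specialize (Sigma_preim f).

End DeltaSymmetric.

(* Main.v *)
From HB Require Import structures.
Require Import Defs.
From mathcomp Require Import all_boot all_order all_algebra all_field.
From mathcomp Require Import boolp classical_sets functions cardinality fsbigop.
From mathcomp Require Import mpoly zify ring perm.

Set Implicit Arguments.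
Unset Strict Implicit.
Unset Printing Implicit Defensive.

Import Order.TTheory GRing.Theory Num.Theory.
Local Open Scope ring_scope.

(* Let M_j(i) be the j-th elementary symmetric polynomial in the q_l, l <> i.
   Modulo p,
     delta S_(j+1) = C_j(S) + sum_i M_j(i)^p q_i',
   where p C_j(S) = S_(j+1)(q_1^p, ..., q_p^p) - S_(j+1)^p over the integers.
   Since - q_i M_j(i) = M_(j+1)(i) - S_(j+1), each power (- q_i)^m, m in Z, is
   sum_j u_(m,j)(S) M_j(i) with u_(m,j) independent of i.  Raise this to the
   power Q = p^t, multiply by a_m and sum over m, which makes sense because
   the terms for different m have different degrees: for any Laurent series g,
     (V^t g)(q_i) = sum_j B_j(S) M_j(i)^Q,
   where V does not act on the coefficients.  For t = 0 this gives
   sum_i g(q_i) = sum_j (p - j) B_j S_j, and for t = s+1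
     sum_i (V^(s+1) g)(q_i) q_i'^(p^s) = sum_j B_j(S) (delta S_(j+1) - C_j(S))^(p^s).
   The symmetrization map is injective: delta S is affine in the q_i', and
   (u_(m,j)) times (M_j(i)) is the Vandermonde matrix of the - q_i, whose
   determinant is regular.  At S_1 = ... = S_(p-1) = 0, S_p = X, the value of
   C_j is found by taking q_i = zeta^i Y with zeta a primitive p-th root of
   unity and X = Y^p: it is binomial(p, j+1)/p X^(j+1) for j+1 < p, and 0 for
   j+1 = p. *)

(** * Substitution in Laurent series *)

(** [lsubst] is a coefficientwise sum that is meaningful only where finitely many exponents
    contribute, and negative powers of a non-unit are default values. So each substitution is first
    shown to be a ring morphism on series supported in a cone. For the map to symmetric series,
    finiteness comes from degrees, since S^e is homogeneous of degree sum_i (i+1) e_i. The minors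
    are the right basis because delta S is affine in the q_i' with linear coefficients M_j(i)^p: an
    expansion along the M_j(i)^Q can be read as one along the s'_j. Using - q_i instead of q_i
    avoids alternating signs. Both terms of the formula are coordinates at the special point. There
    (- q_i)^p = - X, so the exponent m contributes only to the coordinate j congruent to m mod p.
    For the series V^(s+1)(q^(-1) phi), the coordinate p-1 collects the exponents of phi divisible
    by p, which gives U. For j+1 < p, the constant in C_j is (-1)^j/(j+1) mod p; since 1/(j+1) =
    m^(p-2) for the exponents m congruent to j+1, the defects add up to phi^(-1). *)

Ltac zlia := repeat match goal with
  |- context[@fun_of_fin ?a ?b ?c ?d] => move: (@fun_of_fin a b c d) => ?
  end; lia.

Section Coefficients.
Variables (R : comNzRingType) (n : nat).
Local Notation E := {ffun 'I_n -> int}.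
Implicit Types F G : mlaurent R n.

Lemma addE F G d : (F + G) d = F d + G d.
Proof. by []. Qed.

Lemma oppE F d : (- F) d = - F d.
Proof. by []. Qed.

Lemma zeroE d : (0 : mlaurent R n) d = 0.
Proof. by []. Qed.

Lemma monoE (a d : {ffun 'I_n -> int}) : lmono R a d = (d == a)%:R.
Proof. by []. Qed.

Lemma mulE F G d : (F * G) d = \sum_(a \in [set: {ffun 'I_n -> int}]) F a * G (d - a).
Proof. exact: lmulE. Qed.

Definition bounded_by (N : nat) (d : E) := forall i, - N%:Z <= d i.

Definition supp_in (C : E -> Prop) F := forall e, F e != 0 -> C e.

Lemma supp_in0 C : supp_in C 0.
Proof. by move=> e; rewrite zeroE eqxx. Qed.

Lemma supp_inD C F G : supp_in C F -> supp_in C G -> supp_in C (F + G).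
Proof.
move=> hF hG e h; have [Fe|/hF//] := eqVneq (F e) 0.
by apply: hG; move: h; rewrite addE Fe add0r.
Qed.

Lemma supp_inN C F : supp_in C F -> supp_in C (- F).
Proof. by move=> hF e; rewrite oppE oppr_eq0 => /hF. Qed.

Lemma supp_in_sum C I (r : seq I) (P : pred I) (F : I -> mlaurent R n) :
  (forall i, P i -> supp_in C (F i)) -> supp_in C (\sum_(i <- r | P i) F i).
Proof. by move=> h; apply: big_ind => //; [exact: supp_in0 | exact: supp_inD]. Qed.

Lemma supp_in_mono (C : E -> Prop) a : C a -> supp_in C (lmono R a).
Proof.
by move=> Ca e; rewrite monoE; case: (eqVneq e a) => [->|]; rewrite ?eqxx.
Qed.

Lemma supp_inM (A B C : E -> Prop) F G : (forall a b, A a -> B b -> C (a + b)) ->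
  supp_in A F -> supp_in B G -> supp_in C (F * G).
Proof.
move=> AB hF hG e h; apply: contrapT => nC; case/negP: h; apply/eqP.
rewrite mulE fsbig1 // => a _; apply/eqP/negPn/negP => h; apply: nC.
have Fe : F a != 0 by apply: contraNneq h => ->; rewrite mul0r.
have Ge : G (e - a) != 0 by apply: contraNneq h => ->; rewrite mulr0.
by rewrite -[e](subrK a) addrC; apply: AB; [apply: hF|apply: hG].
Qed.

Lemma mulE_supp F G d s : uniq s -> (forall a, a \notin s -> F a * G (d - a) = 0) ->
  (F * G) d = \sum_(a <- s) F a * G (d - a).
Proof.
move=> us h; rewrite mulE (fsbigE s) //; last by move=> a _; exact: h.
by apply: eq_bigl => a; rewrite in_setT.
Qed.

End Coefficients.

Section Substitution.
Variables (R : comNzRingType) (m n : nat).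
Local Notation Em := {ffun 'I_m -> int}.
Local Notation En := {ffun 'I_n -> int}.

Definition gexp (g : 'I_m -> mlaurent R n) (e : Em) : mlaurent R n :=
  \prod_(i < m) g i ^ e i.

(** Conditions that make [lsubst g] a ring morphism on series supported in [C]. [gexpD] is asked on
    [C] because a negative power of a non-unit is a default value. For exponents bounded below by
    -N, the last two fields bound the supports of the powers from below, and bound the exponents
    that reach a given range of [d]. *)
Record evaluable (C : Em -> Prop) (g : 'I_m -> mlaurent R n) : Prop := Evaluable {
  cone0 : C 0;
  coneD : forall a b, C a -> C b -> C (a + b);
  gexpD : forall a b, C a -> C b -> gexp g (a + b) = gexp g a * gexp g b;
  gexp_low : forall N, exists K, forall e, C e -> bounded_by N e ->
    forall d, gexp g e d != 0 -> bounded_by K d;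
  gexp_fin : forall N D, exists K : nat, forall e, C e -> bounded_by N e ->
    forall d, (ebound d <= D)%N -> gexp g e d != 0 -> forall i, `|e i| <= K%:Z }.

Lemma ebound_box M (d : En) : (d \in box n M) = (ebound d <= M)%N.
Proof.
rewrite mem_box; apply/forallP/bigmax_leqP => h i => [_|].
  by have := h i; rewrite -abszE lez_nat.
by rewrite -abszE lez_nat h.
Qed.

Variables (C : Em -> Prop) (g : 'I_m -> mlaurent R n).
Hypothesis Cg : evaluable C g.

Lemma lsubst_lower (F : mlaurent R m) : supp_in C F -> lower_bounded
  (fun d => \sum_(e \in [set: Em]) F e * gexp g e d).
Proof.
move=> FC; have [K hK] := gexp_low Cg (lbnd F).
exists K => d h i; rewrite leNgt; apply: contraNN h => h; apply/eqP.
rewrite fsbig1 // => e _; apply/eqP; apply: contraLR h => h.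
have Fe : F e != 0 by apply: contraNneq h => ->; rewrite mul0r.
have ge : gexp g e d != 0 by apply: contraNneq h => ->; rewrite mulr0.
by rewrite -leNgt; apply: (hK e) => //; [exact: FC | exact: lbndP].
Qed.

Lemma lsubstE (F : mlaurent R m) d : supp_in C F ->
  lsubst g F d = \sum_(e \in [set: Em]) F e * gexp g e d.
Proof. by move=> FC; rewrite [LHS]mklaurentE //; apply: lsubst_lower. Qed.

(** Every larger box is allowed, so that several such sums can be taken over one common box. *)
Lemma lsubst_box D (F : mlaurent R m) : supp_in C F ->
  exists M, forall M', (M <= M')%N -> forall d, (ebound d <= D)%N ->
    lsubst g F d = \sum_(e <- box m M') F e * gexp g e d.
Proof.
move=> FC; have [K hK] := gexp_fin Cg (lbnd F) D.
exists K => M' le d hd; rewrite lsubstE // (@fsum_box _ _ _ M') // => e h i.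
have Fe : F e != 0 by apply: contraNneq h => ->; rewrite mul0r.
have ge : gexp g e d != 0 by apply: contraNneq h => ->; rewrite mulr0.
apply: le_trans (hK e _ _ d hd ge i) _; [exact: FC | exact: lbndP|].
by rewrite lez_nat.
Qed.

Lemma lsubstD (F G : mlaurent R m) : supp_in C F -> supp_in C G ->
  lsubst g (F + G) = lsubst g F + lsubst g G.
Proof.
move=> hF hG; apply: mlaurent_eq => d.
have [M1 h1] := lsubst_box (ebound d) hF.
have [M2 h2] := lsubst_box (ebound d) hG.
have [M3 h3] := lsubst_box (ebound d) (supp_inD hF hG).
pose M := (M1 + M2 + M3)%N.
rewrite addE (h1 M) ?(h2 M) ?(h3 M) ?/M //; try lia.
by rewrite -big_split; apply: eq_bigr => a _; rewrite /= mulrDl.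
Qed.

Lemma lsubst0 : lsubst g 0 = 0.
Proof.
apply: mlaurent_eq => d; rewrite lsubstE; last exact: supp_in0.
by rewrite fsbig1 // => e _; rewrite mul0r.
Qed.

Lemma lsubstN (F : mlaurent R m) : supp_in C F -> lsubst g (- F) = - lsubst g F.
Proof.
move=> hF; apply/eqP; rewrite -subr_eq0 opprK -lsubstD //; last exact: supp_inN.
by rewrite addNr lsubst0.
Qed.

Lemma lsubst_mono a : C a -> lsubst g (lmono R a) = gexp g a.
Proof.
move=> Ca; apply: mlaurent_eq => d; rewrite lsubstE; last exact: supp_in_mono.
rewrite (fsbigE [:: a]) ?big_cons ?big_nil //.
  by rewrite in_setT /= addr0 /lmono_fun eqxx mul1r.
by move=> b _; rewrite inE /= /lmono_fun => /negbTE ->; rewrite mul0r.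
Qed.

Lemma lsubst1 : lsubst g 1 = 1.
Proof.
rewrite [X in lsubst _ X]/(lmono R 0) lsubst_mono; last exact: cone0 Cg.
by apply: big1 => i _; rewrite ffunE expr0z.
Qed.

(** In this form the power of a + c splits as a product, which is how [lsubstM] compares its two
    sides. *)
Lemma lsubst_double (F G : mlaurent R m) d : supp_in C F -> supp_in C G ->
  exists M, forall M', (M <= M')%N ->
    lsubst g (F * G) d = \sum_(a <- box m M') \sum_(c <- box m M')
      F a * G c * gexp g (a + c) d.
Proof.
move=> hF hG; have hFG := supp_inM (coneD Cg) hF hG.
pose N := (lbnd F + lbnd G)%N.
have [K hK] := gexp_fin Cg N (ebound d).
have [M1 h1] := lsubst_box (ebound d) hFG.
(* A bound on a + c bounds a and c separately, because both are bounded below by -N. *)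
have sumK a c : F a != 0 -> G c != 0 -> gexp g (a + c) d != 0 ->
    forall i, `|a i| <= (K + N)%N%:Z /\ `|c i| <= (K + N)%N%:Z.
  move=> Fa Gc gac i; have := lbndP Fa; have := lbndP Gc => hc ha.
  have := hK (a + c) (coneD Cg (hF _ Fa) (hG _ Gc)) _ d (leqnn _) gac i.
  have b : bounded_by N (a + c).
    by move=> j; rewrite ffunE /N; move: (hc j) (ha j); zlia.
  by move=> /(_ b); move: (hc i) (ha i); rewrite !ffunE /N; zlia.
exists (M1 + K + N + N)%N => M' le.
rewrite (h1 (M' + M' + N + ebound d)%N) //; last by zlia.
pose M2 := (M' + M' + N + ebound d + N)%N.
transitivity (\sum_(e <- box m (M' + M' + N + ebound d)) \sum_(a <- box m (M2 + M2))
   F a * (G (e - a) * gexp g e d)).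
  rewrite !big_seq; apply: eq_bigr => e; rewrite mem_box => /forallP he.
  rewrite [(F * G) e](@lmul_box _ _ _ _ _ (M2 + M2)).
    by rewrite mulr_suml; apply: eq_bigr => a _; rewrite mulrA.
  have : (ebound e <= M2)%N.
    by apply/bigmax_leqP => i _; move: (he i); rewrite -abszE lez_nat /M2; zlia.
  by rewrite /M2 /N; zlia.
rewrite exchange_big /=.
(* For fixed a, substitute e = a + c. If no c contributes, both sums vanish; otherwise a is bounded
   and both boxes contain the support. *)
have eqa a : \sum_(e <- box m (M' + M' + N + ebound d)) F a * (G (e - a) * gexp g e d) =
   \sum_(c <- box m M') F a * G c * gexp g (a + c) d.
  have [->|Fa] := eqVneq (F a) 0.
    by rewrite !big1 // => c _; rewrite !mul0r.
  have [[c [Gc gac]]|none] := pselect (exists c, G c != 0 /\ gexp g (a + c) d != 0);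
    last first.
    rewrite big1 ?big1 // => c _.
      have [->|Gc] := eqVneq (G c) 0; first by rewrite mulr0 mul0r.
      have [->|gac] := eqVneq (gexp g (a + c) d) 0; first by rewrite mulr0.
      by case: none; exists c.
    have [->|Gc] := eqVneq (G (c - a)) 0; first by rewrite mul0r mulr0.
    have [->|gac] := eqVneq (gexp g c d) 0; first by rewrite !mulr0.
    by case: none; exists (c - a); rewrite [a + _]addrC subrK.
  have ha i : `|a i| <= (K + N)%N%:Z by have [] := sumK a c Fa Gc gac i.
  rewrite -(@fsum_box _ _ (fun e => F a * (G (e - a) * gexp g e d))).
    rewrite -(@fsum_box _ _ (fun c => F a * G c * gexp g (a + c) d)).
      rewrite (@reindex_fsbigT _ _ _ _ _ (fun e => a + e)).
        by apply: eq_fsbigr => e _; rewrite addrC addKr mulrA addrC.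
      by exists (fun e => e - a) => e /=; rewrite [a + _]addrC ?addrK ?subrK.
    move=> e h i.
    have Ge : G e != 0 by apply: contraNneq h => ->; rewrite mulr0 mul0r.
    have ge : gexp g (a + e) d != 0 by apply: contraNneq h => ->; rewrite mulr0.
    by have [_] := sumK a e Fa Ge ge i; zlia.
  move=> e h i.
  have Ge : G (e - a) != 0 by apply: contraNneq h => ->; rewrite mul0r mulr0.
  have ge : gexp g (a + (e - a)) d != 0.
    by apply: contraNneq h; rewrite addrC subrK => ->; rewrite !mulr0.
  by have [] := sumK a (e - a) Fa Ge ge i; rewrite !ffunE; zlia.
under eq_bigr do rewrite eqa.
rewrite -!(@fsum_box _ _ (fun a => \sum_(c <- box m M') F a * G c * gexp g (a + c) d)) //.
  move=> a h i.
  have [[c [Fa Gc gac]]|none] :=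
    pselect (exists c, [/\ F a != 0, G c != 0 & gexp g (a + c) d != 0]).
    by have [] := sumK a c Fa Gc gac i; zlia.
  case/negP: h; apply/eqP/big1 => c _.
  have [->|Fa] := eqVneq (F a) 0; first by rewrite !mul0r.
  have [->|Gc] := eqVneq (G c) 0; first by rewrite mulr0 mul0r.
  have [->|gac] := eqVneq (gexp g (a + c) d) 0; first by rewrite mulr0.
  by case: none; exists c.
move=> a h i.
have [[c [Fa Gc gac]]|none] :=
  pselect (exists c, [/\ F a != 0, G c != 0 & gexp g (a + c) d != 0]).
  by have [] := sumK a c Fa Gc gac i; rewrite /M2; zlia.
case/negP: h; apply/eqP/big1 => c _.
have [->|Fa] := eqVneq (F a) 0; first by rewrite !mul0r.
have [->|Gc] := eqVneq (G c) 0; first by rewrite mulr0 mul0r.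
have [->|gac] := eqVneq (gexp g (a + c) d) 0; first by rewrite mulr0.
by case: none; exists c.
Qed.

Lemma lsubstM (F G : mlaurent R m) : supp_in C F -> supp_in C G ->
  lsubst g (F * G) = lsubst g F * lsubst g G.
Proof.
move=> hF hG; apply: mlaurent_eq => d.
have [M0 h0] := lsubst_double d hF hG.
have [K hK] := gexp_low Cg (lbnd F + lbnd G).
(* When both powers contribute, b and d - b are bounded below by -K, so b lies in a box of radius K
   + [ebound d]. *)
pose B := (lbnd (lsubst g F) + lbnd (lsubst g G) + ebound d + K + K)%N.
have [M1 h1] := lsubst_box (B + ebound d) hF.
have [M2 h2] := lsubst_box (B + ebound d) hG.
pose M := (M0 + M1 + M2)%N.
rewrite [RHS](@lmul_box _ _ _ _ _ B); last by rewrite /B; zlia.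
rewrite (h0 M); last by rewrite /M; zlia.
transitivity (\sum_(b <- box n B) \sum_(a <- box m M) \sum_(c <- box m M)
  F a * G c * (gexp g a b * gexp g c (d - b))); last first.
  rewrite !big_seq; apply: eq_bigr => b; rewrite ebound_box => hb.
  have hd : (ebound (d - b)%R <= B + ebound d)%N.
    apply/bigmax_leqP => i _; rewrite !ffunE.
    by have := eboundP d i; have := eboundP b i; move: hb; zlia.
  rewrite (h1 M) ?(h2 M) ?/M; try zlia.
  rewrite mulr_suml; apply: eq_bigr => a _; rewrite mulr_sumr; apply: eq_bigr => c _.
  by rewrite mulrACA.
rewrite [RHS]exchange_big; apply: eq_bigr => a _; rewrite [RHS]exchange_big; apply: eq_bigr => c _.
rewrite -mulr_sumr.
have [->|Fa] := eqVneq (F a) 0; first by rewrite !mul0r.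
have [->|Gc] := eqVneq (G c) 0; first by rewrite mulr0 !mul0r.
rewrite (gexpD Cg) ?[_ d]lmulE; [|exact: hF|exact: hG].
congr (_ * _); apply: fsum_box => b h i.
have ga : gexp g a b != 0 by apply: contraNneq h => ->; rewrite mul0r.
have gc : gexp g c (d - b) != 0 by apply: contraNneq h => ->; rewrite mulr0.
have l1 : bounded_by K b.
  by apply: (hK a) ga; [exact: hF | move=> j; have := lbndP Fa j; zlia].
have l2 : bounded_by K (d - b).
  by apply: (hK c) gc; [exact: hG | move=> j; have := lbndP Gc j; zlia].
have := l1 i; have := l2 i; have := eboundP d i; rewrite !ffunE /B; zlia.
Qed.

End Substitution.

Section Closed.
Variables (R : comNzRingType) (n : nat).
Local Notation E := {ffun 'I_n -> int}.

Definition orthant (e : E) := forall i, 0 <= e i.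
Definition last_cone (e : E) := forall i : 'I_n, i.+1 != n -> 0 <= e i.

Lemma powserP (F : mlaurent R n) : reflect (supp_in orthant F) (F \in powser).
Proof. by apply: (iffP idP) => [/asboolP|h]; last exact/asboolP. Qed.

Lemma powser_lastP (F : mlaurent R n) :
  reflect (supp_in last_cone F) (F \in powser_last).
Proof. by apply: (iffP idP) => [/asboolP|h]; last exact/asboolP. Qed.

Lemma orthant0 : orthant 0. Proof. by move=> i; rewrite ffunE. Qed.

Lemma orthantD a b : orthant a -> orthant b -> orthant (a + b).
Proof. by move=> ha hb i; rewrite ffunE addr_ge0. Qed.

Lemma last_cone0 : last_cone 0. Proof. by move=> i _; rewrite ffunE. Qed.

Lemma last_coneD a b : last_cone a -> last_cone b -> last_cone (a + b).
Proof. by move=> ha hb i hi; rewrite ffunE addr_ge0 ?ha ?hb. Qed.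

Lemma powser_subring : subring_closed (@powser R n).
Proof.
split.
- by apply/powserP; apply: supp_in_mono orthant0.
- move=> F G /powserP hF /powserP hG; apply/powserP.
  exact: supp_inD hF (supp_inN hG).
- move=> F G /powserP hF /powserP hG; apply/powserP.
  exact: supp_inM orthantD hF hG.
Qed.

Lemma powser_last_subring : subring_closed (@powser_last R n).
Proof.
split.
- by apply/powser_lastP; apply: supp_in_mono last_cone0.
- move=> F G /powser_lastP hF /powser_lastP hG; apply/powser_lastP.
  exact: supp_inD hF (supp_inN hG).
- move=> F G /powser_lastP hF /powser_lastP hG; apply/powser_lastP.
  exact: supp_inM last_coneD hF hG.
Qed.

HB.instance Definition _ :=
  GRing.isSubringClosed.Build (mlaurent R n) (@powser R n) powser_subring.
HB.instance Definition _ :=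
  GRing.isSubringClosed.Build (mlaurent R n) (@powser_last R n) powser_last_subring.

Lemma powserW (F : mlaurent R n) : F \in powser -> F \in powser_last.
Proof. by move/powserP => h; apply/powser_lastP => e /h he i _; apply: he. Qed.

(* R[[x_1, ..., x_n]][1/x_n] as a ring of its own: on it the substitutions
   [lsubst] used below are ring morphisms. *)
Record lseries := LSeries { lval :> mlaurent R n; _ : lval \in powser_last }.
HB.instance Definition _ := [isSub for lval].
HB.instance Definition _ := [Choice of lseries by <:].
HB.instance Definition _ := [SubChoice_isSubComNzRing of lseries by <:].

Lemma lval_cone (F : lseries) : supp_in last_cone (lval F).
Proof. by apply/powser_lastP; case: F. Qed.

End Closed.

Section Evaluation.
Variables (R : comNzRingType) (m n : nat) (g : 'I_m -> mlaurent R n).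
Hypothesis Cg : evaluable (@last_cone m) g.

(** The proof of evaluability is an argument so that the morphism structures can be attached to
    [leval Cg]. *)
Definition leval of evaluable (@last_cone m) g :=
  fun F : lseries R m => lsubst g (lval F).

Lemma leval_zmod : zmod_morphism (leval Cg).
Proof.
move=> F G; rewrite /leval /= (lsubstD Cg); try exact: lval_cone.
  by rewrite (lsubstN Cg) //; exact: lval_cone.
by apply: supp_inN; apply: lval_cone.
Qed.

Lemma leval_monoid : monoid_morphism (leval Cg).
Proof.
split=> [|F G]; rewrite /leval /=; first exact: lsubst1 Cg.
by rewrite (lsubstM Cg) //; exact: lval_cone.
Qed.

HB.instance Definition _ := GRing.isZmodMorphism.Build _ _ (leval Cg) leval_zmod.
HB.instance Definition _ := GRing.isMonoidMorphism.Build _ _ (leval Cg) leval_monoid.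

End Evaluation.

(** * Monomials and total degree *)

Section Homogeneous.
Variables (R : comNzRingType) (n : nat).
Local Notation E := {ffun 'I_n -> int}.
Implicit Types (a b e : E) (F G : mlaurent R n).

Lemma lmonoM a b : lmono R a * lmono R b = lmono R (a + b).
Proof.
apply: mlaurent_eq => d; rewrite [LHS]lmul_monol !monoE subr_eq addrC.
by rewrite [a + b]addrC.
Qed.

Lemma lmono0 : lmono R (0 : E) = 1.
Proof. by []. Qed.

Lemma lmonoXn a m : lmono R a ^+ m = lmono R (a *+ m).
Proof. by elim: m => [|m IH]; rewrite ?lmono0 // exprS IH lmonoM mulrS. Qed.

Lemma lmonoV a : (lmono R a)^-1 = lmono R (- a).
Proof. by apply: mulr1_eq; rewrite lmonoM subrr. Qed.

Lemma lmono_unit a : lmono R a \is a GRing.unit.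
Proof. by apply/unitrPr; exists (lmono R (- a)); rewrite lmonoM subrr. Qed.

Lemma expMzE a z i : (a *~ z) i = a i * z.
Proof. by rewrite ffunMzE mulrzz. Qed.

Lemma lmonoXz a z : lmono R a ^ z = lmono R (a *~ z).
Proof.
case: z => m; first by rewrite -exprnP lmonoXn.
by rewrite NegzE -exprz_inv -exprnP lmonoV lmonoXn mulrNz mulNrn.
Qed.

Lemma lmono_prod I (r : seq I) (P : pred I) (f : I -> E) :
  \prod_(i <- r | P i) lmono R (f i) = lmono R (\sum_(i <- r | P i) f i).
Proof.
by rewrite (big_morph (lmono R (n := n)) (fun a b => esym (lmonoM a b)) lmono0).
Qed.

Lemma supp_in_bounded_prod I (r : seq I) (f : I -> mlaurent R n) N :
  (forall i, supp_in (bounded_by N) (f i)) ->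
  supp_in (bounded_by (size r * N)) (\prod_(i <- r) f i).
Proof.
move=> h; elim: r => [|i r IH]; rewrite ?big_nil ?big_cons /=.
  by rewrite -lmono0; apply: supp_in_mono => i; rewrite ffunE.
apply: supp_inM (h i) IH => a b ha hb j.
by rewrite ffunE mulSn; move: (ha j) (hb j); clear; zlia.
Qed.

Definition tdeg (d : E) : int := \sum_i d i.

Lemma tdegD a b : tdeg (a + b) = tdeg a + tdeg b.
Proof. by rewrite -big_split; apply: eq_bigr => i _; rewrite ffunE. Qed.

Lemma tdegN a : tdeg (- a) = - tdeg a.
Proof. by rewrite -sumrN; apply: eq_bigr => i _; rewrite ffunE. Qed.

Lemma tdegMz a z : tdeg (a *~ z) = tdeg a * z.
Proof. by rewrite mulr_suml; apply: eq_bigr => i _; rewrite expMzE. Qed.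

Lemma tdeg_bound (d : E) : `|tdeg d| <= (n * ebound d)%N%:Z.
Proof.
apply: le_trans (ler_norm_sum _ _ _) _.
apply: le_trans (ler_sum _ (fun i _ => eboundP d i)) _.
by rewrite sumr_const card_ord -mulr_natl natz PoszM.
Qed.

Definition isobaric (c : int) F := supp_in (fun d : E => tdeg d = c) F.


Lemma isobaricM c c' F G : isobaric c F -> isobaric c' G -> isobaric (c + c') (F * G).
Proof. by apply: supp_inM => a b; rewrite tdegD => -> ->. Qed.

Lemma isobaric1 : isobaric 0 1.
Proof. by apply: supp_in_mono; rewrite /tdeg big1 // => i _; rewrite ffunE. Qed.

Lemma isobaricX c F m : isobaric c F -> isobaric (c * m%:Z) (F ^+ m).
Proof.
move=> hF; elim: m => [|m IH]; first by rewrite mulr0; apply: isobaric1.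
by rewrite exprS intS mulrDr mulr1; apply: isobaricM.
Qed.

Lemma isobaric_prod I (r : seq I) (f : I -> mlaurent R n) (c : I -> int) :
  (forall i, isobaric (c i) (f i)) -> isobaric (\sum_(i <- r) c i) (\prod_(i <- r) f i).
Proof.
move=> h; elim: r => [|i r IH]; rewrite ?big_nil ?big_cons; first exact: isobaric1.
exact: isobaricM.
Qed.

End Homogeneous.


Section LastCone.
Variables (R : comNzRingType) (m n : nat) (g : 'I_m -> mlaurent R n).
Hypothesis g_last : forall i : 'I_m, i.+1 = m -> g i \is a GRing.unit.

Lemma gexpD_last a b : last_cone a -> last_cone b -> gexp g (a + b) = gexp g a * gexp g b.
Proof.
move=> ha hb; rewrite -big_split; apply: eq_bigr => i _; rewrite ffunE /=.
have [/eqP im|im] := boolP (i.+1 == m); first by rewrite exprzDr ?g_last.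
by rewrite exprzD_ss // ha ?hb.
Qed.

Lemma gexp_low_last :
    (forall i, supp_in (@bounded_by n 0) (g i)) ->
    (forall i : 'I_m, i.+1 = m -> forall (N : nat) z, - N%:Z <= z ->
       supp_in (bounded_by N) (g i ^ z)) ->
  forall N, exists K, forall e, last_cone e -> bounded_by N e ->
    supp_in (bounded_by K) (gexp g e).
Proof.
move=> h0 hl N; exists (size (index_enum 'I_m) * N)%N => e he hN.
apply: supp_in_bounded_prod => i.
have [/eqP im|im] := boolP (i.+1 == m); first exact: hl.
have := he i im; case: (e i) => // l _.
have : supp_in (@bounded_by n 0) (g i ^+ l).
  elim: l => [|l IH]; first by rewrite expr0 -lmono0; apply: supp_in_mono => j; rewrite ffunE.
  rewrite exprS; apply: supp_inM (h0 i) IH => a b ha hb j.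
  by rewrite ffunE; move: (ha j) (hb j); clear; zlia.
by move=> h d /h hd j; move: (hd j); clear; zlia.
Qed.

End LastCone.

(** * Evaluability of the three substitutions *)

Section Instances.
Variables (k : comNzRingType) (p : nat).
Hypothesis p_gt0 : (0 < p)%N.
Local Notation E := {ffun 'I_p -> int}.

Lemma lesymE (j : 'I_p) :
  lesym k j = \sum_(h : {set 'I_p} | #|h| == j.+1) lmono k [ffun i => (i \in h)%:Z].
Proof.
rewrite /lesym mesymE (raddf_sum (mmap _ _)) /=; apply: eq_bigr => h _.
rewrite mmapX /mmap1.
under eq_bigr => i _ do rewrite mnmE lmonoXn.
rewrite lmono_prod; congr lmono; apply/ffunP => i.
rewrite sum_ffunE ffunE (bigD1 i) //= big1 ?addr0.
  by rewrite pmulrn expMzE ffunE eqxx mul1r.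
by move=> l li; rewrite pmulrn expMzE ffunE eq_sym (negbTE li) mul0r.
Qed.

Lemma lesym_last (j : 'I_p) : j.+1 = p -> lesym k j = lmono k [ffun=> 1].
Proof.
move=> jp; rewrite lesymE (bigD1 [set: 'I_p]) /= ?cardsT ?card_ord ?jp //.
rewrite big1 ?addr0; last first.
  move=> h /andP[/eqP hc /negP[]]; rewrite eqEcard finset.subsetT cardsT card_ord.
  by rewrite hc leqnn.
by congr lmono; apply/ffunP => i; rewrite !ffunE inE.
Qed.

Lemma lesym_isobaric (j : 'I_p) : isobaric j.+1 (lesym k j).
Proof.
rewrite lesymE; apply: supp_in_sum => h /eqP hc; apply: supp_in_mono.
rewrite /tdeg -hc -sum1_card -natz natr_sum [RHS]big_mkcond.
by apply: eq_bigr => i _; rewrite ffunE; case: (i \in h).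
Qed.

Lemma lesym_bounded (j : 'I_p) : supp_in (@bounded_by p 0) (lesym k j).
Proof.
by rewrite lesymE; apply: supp_in_sum => h _; apply: supp_in_mono => i; rewrite ffunE.
Qed.

Definition wt (e : E) : int := \sum_(i < p) i.+1%:Z * e i.

Lemma gexp_lesym_isobaric e : last_cone e -> isobaric (wt e) (gexp (@lesym p k) e).
Proof.
move=> he; apply: isobaric_prod => i.
have [/eqP ip|ip] := boolP (i.+1 == p).
  rewrite lesym_last // lmonoXz; apply: supp_in_mono.
  rewrite tdegMz ip; congr (_ * _); rewrite /tdeg.
  under eq_bigr do rewrite ffunE.
  by rewrite sumr_const card_ord natz.
have := he i ip; case: (e i) => // l _.
by rewrite -exprnP; apply: isobaricX; apply: lesym_isobaric.
Qed.

(** All the weights i+1 are positive, and the p - 1 other coordinates together contribute at least -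
    p (p N). A large coordinate therefore cannot be compensated. *)
Lemma wt_bound e (N D : nat) : bounded_by N e -> `|wt e| <= D%:Z ->
  forall i, `|e i| <= (D + p * (p * N) + N)%N%:Z.
Proof.
move=> hN hD i; have : wt e = i.+1%:Z * e i + \sum_(l < p | l != i) l.+1%:Z * e l.
  by rewrite /wt (bigD1 i).
have : - (p * (p * N))%N%:Z <= \sum_(l < p | l != i) l.+1%:Z * e l.
  have le1 : \sum_(l < p | l != i) - (p * N)%N%:Z <= \sum_(l < p | l != i) l.+1%:Z * e l.
    apply: ler_sum => l _; have := ltn_ord l; have := hN l; clear; move: (e l) => z.
    rewrite PoszM; nia.
  apply: le_trans le1; rewrite sumr_const mulNrn lerN2 -mulr_natl natz -PoszM lez_nat.
  by rewrite leq_mul2r (leq_trans (max_card _)) ?card_ord ?leqnn ?orbT.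
move: hD (hN i); move: (\sum_(l < p | _) _) (e i) (wt e) => s z w.
have : 1 <= i.+1%:Z by [].
clear; move: (p * (p * N))%N i.+1%:Z => q y; nia.
Qed.

(** A monomial [d] occurs in S^e only if [wt e] is the total degree of [d], and [wt_bound] leaves
    finitely many such e. The last elementary symmetric polynomial is a monomial, hence a unit. *)
Lemma lesym_evaluable : evaluable (@last_cone p) (@lesym p k).
Proof.
have lu (i : 'I_p) : i.+1 = p -> lesym k i \is a GRing.unit.
  by move=> ip; rewrite lesym_last // lmono_unit.
split.
- exact: last_cone0.
- exact: last_coneD.
- exact: gexpD_last.
- move=> N; apply: gexp_low_last lesym_bounded _ N => i ip M z hz.
  by rewrite lesym_last // lmonoXz; apply: supp_in_mono => j; rewrite expMzE ffunE mul1r.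
- move=> N D; exists (p * D + p * (p * N) + N)%N => e he hN d hd ge i.
  apply: wt_bound => //; rewrite -(gexp_lesym_isobaric he ge).
  by apply: le_trans (tdeg_bound d) _; rewrite lez_nat leq_mul2l hd orbT.
Qed.

Definition lspec (i : 'I_p) : mlaurent k 1 := if i.+1 == p then lX k else 0.

Definition elast (z : int) : E := [ffun i : 'I_p => if i.+1 == p then z else 0].

Lemma gexp_lspec_elast z : gexp lspec (elast z) = lmono k [ffun=> z].
Proof.
have pp : (p.-1 < p)%N by case: p p_gt0.
rewrite /gexp (bigD1 (Ordinal pp)) //= big1 ?mulr1.
  rewrite /lspec ffunE /= prednK // eqxx lmonoXz; congr lmono; apply/ffunP => i.
  by rewrite expMzE !ffunE (ord1 i) eqxx mul1r.
move=> i hi; rewrite ffunE ifN ?expr0z //.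
by apply: contraNN hi => /eqP ip; apply/eqP/val_inj; move: ip; clear => /=; lia.
Qed.

Lemma gexp_lspec_eq0 e (l : 'I_p) : last_cone e -> l.+1 = p -> e != elast (e l) ->
  gexp lspec e = 0.
Proof.
move=> he lp ne.
suff [i [ip ei]] : exists i : 'I_p, i.+1 != p /\ e i != 0.
  rewrite /gexp (bigD1 i) //= /lspec (negbTE ip).
  move: (he i ip) ei; case: (e i) => // -[|n] // _ _.
  by rewrite -exprnP expr0n mul0r.
apply: contrapT => nex; case/negP: ne; apply/eqP/ffunP => i; rewrite ffunE.
case: eqP => [ip|/eqP ip].
  by congr (e _); apply/val_inj/succn_inj; rewrite ip lp.
by apply/eqP/negPn/negP => ei; apply: nex; exists i.
Qed.

Lemma elastK z (l : 'I_p) : l.+1 = p -> elast z l = z.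
Proof. by move=> lp; rewrite ffunE lp eqxx. Qed.

Lemma lX_Xz z : lX k ^ z = lmono k [ffun=> z].
Proof.
rewrite lmonoXz; congr lmono; apply/ffunP => i.
by rewrite expMzE !ffunE (ord1 i) eqxx mul1r.
Qed.

Lemma lspec_evaluable : evaluable (@last_cone p) lspec.
Proof.
have pp : (p.-1 < p)%N by case: p p_gt0.
have lp : (Ordinal pp).+1 = p by rewrite /= prednK.
split.
- exact: last_cone0.
- exact: last_coneD.
- apply: gexpD_last => i ip; rewrite /lspec ip eqxx; exact: lmono_unit.
- move=> N; apply: gexp_low_last N => [i|i ip M z hz]; rewrite /lspec.
    by case: ifP => _; [apply: supp_in_mono => j; rewrite ffunE | exact: supp_in0].
  by rewrite ip eqxx lX_Xz; apply: supp_in_mono => j; rewrite ffunE.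
- move=> N D; exists D => e he hN d hd ge i.
  have [ee|ne] := eqVneq e (elast (e (Ordinal pp))); last first.
    by rewrite (gexp_lspec_eq0 he lp ne) zeroE eqxx in ge.
  move: ge; rewrite ee gexp_lspec_elast monoE; have [dd _|] := eqVneq d _; last by rewrite eqxx.
  have := eboundP d ord0; rewrite dd !ffunE => h.
  by case: ifP => _ //; apply: le_trans h _; rewrite lez_nat -dd.
Qed.

Definition lline (i : 'I_p) (z : int) : E := [ffun j => if j == i then z else 0].

Lemma gexp_lvar (i : 'I_p) (e : {ffun 'I_1 -> int}) :
  gexp (fun=> lvar k i) e = lmono k (lline i (e ord0)).
Proof.
rewrite /gexp big_ord1 lmonoXz; congr lmono; apply/ffunP => j.
by rewrite expMzE !ffunE; case: (j == i); rewrite ?mul1r ?mul0r.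
Qed.

Lemma lvar_evaluable (i : 'I_p) : evaluable (@last_cone 1) (fun=> lvar k i).
Proof.
split.
- exact: last_cone0.
- exact: last_coneD.
- by apply: gexpD_last => *; apply: lmono_unit.
- move=> N; exists N => e _ he d; rewrite gexp_lvar => h.
  apply: (supp_in_mono (C := bounded_by N) _ h) => j.
  by rewrite ffunE; case: ifP => _; rewrite ?oppr_le0 ?he.
- move=> N D; exists D => e _ _ d hd; rewrite gexp_lvar monoE.
  have [dd _ l|] := eqVneq d _; last by rewrite eqxx.
  have := eboundP d i; rewrite {1}dd ffunE eqxx (ord1 l) => h.
  by apply: le_trans h _; rewrite lez_nat.
Qed.

End Instances.

Section Values.
Variables (k : comNzRingType) (p : nat).
Hypothesis p_gt0 : (0 < p)%N.
Local Notation E := {ffun 'I_p -> int}.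

Lemma last_cone1 (e : {ffun 'I_1 -> int}) : last_cone e.
Proof. by move=> i; rewrite (ord1 i). Qed.

Lemma lsubst_lvarE (F : mlaurent k 1) (i : 'I_p) (d : E) :
  lsubst (fun=> lvar k i) F d = if d == lline i (d i) then F [ffun=> d i] else 0.
Proof.
rewrite (lsubstE (lvar_evaluable k i)); last by move=> e _; apply: last_cone1.
case: eqP => [dd|nd].
  rewrite (fsbigE [:: [ffun=> d i]]) ?big_cons ?big_nil //.
    by rewrite in_setT /= addr0 gexp_lvar monoE ffunE -dd eqxx mulr1.
  move=> e _; rewrite inE gexp_lvar monoE => ne.
  have [de|] := eqVneq d (lline i (e ord0)); last by rewrite mulr0.
  case/negP: ne; apply/eqP/ffunP => j.
  by rewrite ffunE (ord1 j) de ffunE eqxx.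
rewrite fsbig1 // => e _; rewrite gexp_lvar monoE.
have [de|] := eqVneq d _; last by rewrite mulr0.
by case: nd; rewrite {1}de; congr lline; rewrite de ffunE eqxx.
Qed.

(** [lphi] and [lsig] are the actions of [sym_map] and [specialize] on coefficients, as ring
    morphisms on [lseries]. *)
Definition lphi := leval (@lesym_evaluable k p).
Definition lsig := leval (lspec_evaluable k p_gt0).
HB.instance Definition _ := GRing.RMorphism.on lphi.
HB.instance Definition _ := GRing.RMorphism.on lsig.

Lemma lsigE (F : lseries k p) z : lsig F [ffun=> z] = lval F (elast p z).
Proof.
have pp : (p.-1 < p)%N by case: p p_gt0.
have lp : (Ordinal pp).+1 = p by rewrite /= prednK.
rewrite [LHS](lsubstE (lspec_evaluable k p_gt0)); last exact: lval_cone.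
rewrite (fsbigE [:: elast p z]) ?big_cons ?big_nil //.
  by rewrite in_setT /= addr0 gexp_lspec_elast // monoE eqxx mulr1.
move=> e _; rewrite inE => ne.
have [->|Fe] := eqVneq (lval F e) 0; first by rewrite mul0r.
have [ee|ne'] := eqVneq e (elast p (e (Ordinal pp))); last first.
  by rewrite (gexp_lspec_eq0 _ _ lp ne') ?zeroE ?mulr0 //; apply: (lval_cone Fe).
rewrite ee gexp_lspec_elast // monoE.
have [h|] := eqVneq [ffun=> z] _; last by rewrite mulr0.
by case/negP: ne; rewrite ee; move/ffunP: h => /(_ ord0); rewrite !ffunE => <-.
Qed.

End Values.

(** * The minors of the elementary symmetric polynomials *)

Section ElementaryPolynomial.
Variables (A : comNzRingType) (n : nat).
Implicit Types x : 'I_n -> A.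

(** Generating polynomials: the coefficient of index j of [eminor x i] is M_j(i). There is an index
    shift between [epoly] and [lesym]: [lesym k j] is the coefficient of index j+1. *)
Definition epoly x : {poly A} := \prod_(l < n) (1 + x l *: 'X).
Definition eminor x i : {poly A} := \prod_(l < n | l != i) (1 + x l *: 'X).

Lemma coef_epoly x j :
  (epoly x)`_j = \sum_(h : {set 'I_n} | #|h| == j) \prod_(i in h) x i.
Proof.
rewrite /epoly; under eq_bigr do rewrite addrC.
rewrite bigA_distr coef_sum [RHS]big_mkcond; apply: eq_bigr => h _.
rewrite -big_mkcond /= (eq_bigr (fun i => x i *: 'X)); last by [].
rewrite scaler_prod prodr_const coefZ coefXn eq_sym.
by case: (_ == _); rewrite ?mulr1 ?mulr0.
Qed.

Lemma epoly_minor x i : epoly x = (1 + x i *: 'X) * eminor x i.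
Proof. by rewrite /epoly (bigD1 i). Qed.

Lemma epoly0 x : (epoly x)`_0 = 1.
Proof.
rewrite -horner_coef0 horner_prod big1 // => l _.
by rewrite hornerD hornerZ hornerX mulr0 addr0 hornerC.
Qed.

Lemma eminor0 x i : (eminor x i)`_0 = 1.
Proof.
have := epoly0 x; rewrite (epoly_minor x i) mulrDl mul1r coefD -scalerAl coefZ.
by rewrite coefXM eqxx mulr0 addr0.
Qed.

Lemma eminorS x i j :
  (eminor x i)`_j.+1 = (epoly x)`_j.+1 - x i * (eminor x i)`_j.
Proof.
rewrite (epoly_minor x i) mulrDl mul1r coefD -scalerAl coefZ.
by rewrite coefXM addrK.
Qed.

Lemma size_eminor x i : (size (eminor x i) <= n)%N.
Proof.
apply: leq_trans (size_poly_prod_leq _ _) _.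
have c : (#|[pred l : 'I_n | l != i]|).+1 = n.
  by have := cardC1 i; rewrite card_ord => ->; rewrite prednK // (leq_ltn_trans _ (ltn_ord i)).
have : (\sum_(l < n | l != i) size (1 + x l *: 'X)%R <= \sum_(l < n | l != i) 2)%N.
  apply: leq_sum => l _; apply: leq_trans (size_polyD _ _) _.
  by rewrite geq_max size_poly1 /= (leq_trans (size_scale_leq _ _)) ?size_polyX.
rewrite sum_nat_const => h.
have arith (a b : nat) : a.+1 = n -> (b <= a * 2)%N -> (b.+1 - a <= n)%N by lia.
exact: arith c h.
Qed.

End ElementaryPolynomial.

Lemma map_epoly (A B : comNzRingType) (f : {rmorphism A -> B}) n (x : 'I_n -> A) :
  map_poly f (epoly x) = epoly (f \o x).
Proof.
rewrite rmorph_prod; apply: eq_bigr => l _.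
by rewrite rmorphD rmorph1 /= linearZ /= map_polyX.
Qed.

Lemma mmap_mesym (R A : comNzRingType) (f : {rmorphism R -> A}) n (x : 'I_n -> A) j :
  mmap f x (mesym n R j) = (epoly x)`_j.
Proof.
rewrite mesymE coef_epoly raddf_sum /=; apply: eq_bigr => h _.
rewrite mmapX /mmap1 [RHS]big_mkcond; apply: eq_bigr => i _.
by rewrite mnmE; case: (i \in h); rewrite ?expr1 ?expr0.
Qed.

Lemma big_nat_last (A : nmodType) (n : nat) (F : nat -> A) : (0 < n)%N ->
  \sum_(0 <= j < n) F j = \sum_(0 <= j < n.-1) F j + F n.-1.
Proof. by case: n => // n _; rewrite big_nat_recr. Qed.

(** * Coordinates of the powers of - q_i in the minors *)

Section Family.
Variables (k : comNzRingType) (p : nat).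
Hypothesis p_gt0 : (0 < p)%N.
Local Notation S := (lseries k p).
Local Notation q := (lvar k (n := p)).
Local Notation phi := (@lphi k p).
Local Notation sig := (@lsig k p p_gt0).

Lemma epoly_lesym (j : 'I_p) : (epoly q)`_j.+1 = lesym k j.
Proof. by rewrite -(mmap_mesym (intmul 1 : {rmorphism int -> mlaurent k p})). Qed.

Lemma svar_subproof (j : 'I_p) : lvar k j \in powser.
Proof. by apply/powserP; apply: supp_in_mono => i; rewrite ffunE. Qed.

Definition svar (j : 'I_p) : S := LSeries (powserW (svar_subproof j)).

Lemma lphi_svar j : phi (svar j) = lesym k j.
Proof.
rewrite [LHS](lsubst_mono (@lesym_evaluable k p)); last first.
  by move=> i _; rewrite ffunE.
rewrite /gexp (bigD1 j) //= big1 ?mulr1 => [|i ij].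
  by rewrite ffunE eqxx expr1z.
by rewrite ffunE (negbTE ij) expr0z.
Qed.

Lemma elast1 (j : 'I_p) : j.+1 = p -> elast p 1 = [ffun i => (i == j)%:Z].
Proof.
move=> jp; apply/ffunP => i; rewrite !ffunE.
have -> : (i.+1 == p) = (i == j).
  by apply/eqP/eqP => [ip|-> //]; apply: val_inj; move: ip jp; clear => /=; lia.
by case: (i == j).
Qed.

Lemma lsig_svar j : sig (svar j) = if j.+1 == p then lX k else 0.
Proof.
apply: mlaurent_eq => d; have -> : d = [ffun=> d ord0].
  by apply/ffunP => i; rewrite ffunE (ord1 i).
rewrite lsigE /= /lmono_fun.
case: (j.+1 =P p) => [jp|/eqP jp]; last first.
  rewrite zeroE; case: eqP => // /ffunP/(_ j).
  by rewrite !ffunE (negbTE jp) eqxx.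
rewrite -(elast1 jp) -[lX k]expr1z lX_Xz monoE; congr (_%:R : k).
have pj : elast p (d ord0) j = d ord0 by rewrite elastK.
congr nat_of_bool; apply/eqP/eqP => /ffunP h.
  by apply/ffunP => i; rewrite !ffunE -[LHS]pj h elastK.
by have := h ord0; rewrite !ffunE => ->.
Qed.

Definition olast : 'I_p := Ordinal (eq_ind_r (leq^~ p) (leqnn p) (prednK p_gt0)).

Lemma olastE : olast.+1 = p. Proof. exact: prednK. Qed.

Lemma eq_olast (j : 'I_p) : (j.+1 == p) = (j == olast).
Proof.
apply/eqP/eqP => [jp|->]; last exact: olastE.
by apply: val_inj; apply: succn_inj; rewrite jp olastE.
Qed.

Lemma sinv_subproof : lmono k [ffun i : 'I_p => - (i == olast)%:Z] \in powser_last.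
Proof.
apply/powser_lastP; apply: supp_in_mono => i ip; rewrite ffunE.
by move: ip; rewrite eq_olast => /negbTE ->.
Qed.

Definition sinv : S := LSeries sinv_subproof.

Lemma sinvK : sinv * svar olast = 1.
Proof.
apply: val_inj; rewrite /= lmonoM -lmono0; congr lmono; apply/ffunP => i.
by rewrite !ffunE addNr.
Qed.

(* If [u] are the coordinates of [f] in the minors [M_j] for all [q_i], then
   [scompanion u] are those of [- q_i f], as [- q_i M_j = M_(j+1) - e_(j+1)]. *)
Definition scompanion (u : nat -> S) (j : nat) : S :=
  if j is j'.+1 then u j' else - \sum_(l < p) u l * svar l.

(** Division by - q_i moves the coordinates down by one. The top one is then forced by the equation
    in index 0, where it is multiplied by s_p; this is where s_p must be inverted. *)
Definition scompanion_inv (u : nat -> S) (j : nat) : S :=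
  if (j.+1 < p)%N then u j.+1
  else - (sinv * (u 0 + \sum_(l < p | l != olast) u l.+1 * svar l)).

Lemma scompanionK u j : (j < p)%N -> scompanion (scompanion_inv u) j = u j.
Proof.
case: j => [_|j jp] /=; last by rewrite /scompanion_inv jp.
rewrite (bigD1 olast) //= {1}/scompanion_inv olastE ltnn.
rewrite mulNr mulrAC sinvK mul1r opprD opprK.
under [X in _ - X]eq_bigr => l ll do
  rewrite /scompanion_inv ltn_neqAle ltn_ord eq_olast ll.
by rewrite addrK.
Qed.

Local Notation M i j := (eminor q i)`_j.

Definition minor_comb (u : nat -> S) (i : 'I_p) : mlaurent k p :=
  \sum_(j < p) phi (u j) * M i j.

Lemma minor_comb_scompanion u i : minor_comb (scompanion u) i = - q i * minor_comb u i.
Proof.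
have step (j : 'I_p) : - q i * (phi (u j) * M i j) =
    phi (u j) * M i j.+1 - phi (u j * svar j).
  by rewrite rmorphM /= lphi_svar -epoly_lesym eminorS; clear; ring.
rewrite /minor_comb mulr_sumr (eq_bigr _ (fun j _ => step j)) sumrB.
rewrite -(big_mkord xpredT (fun j => phi (scompanion u j) * M i j)) big_ltn //.
rewrite -(big_mkord xpredT (fun j => phi (u j) * M i j.+1)) big_add1.
(* The top term drops out because M_p(i) = 0. Since M_0(i) = 1, the terms in S_(l+1) add up to the
   new coordinate of index 0. *)
rewrite [in RHS]big_nat_last // prednK //.
rewrite [(eminor q i)`_p]nth_default ?size_eminor // mulr0 addr0.
by rewrite eminor0 mulr1 addrC rmorphN /= rmorph_sum.
Qed.

Lemma minor_comb_eq u v i : (forall j, (j < p)%N -> u j = v j) ->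
  minor_comb u i = minor_comb v i.
Proof. by move=> uv; apply: eq_bigr => j _; rewrite uv. Qed.

(* The value at [s_1 = ... = s_(p-1) = 0, s_p = X] of the [j]-th coordinate of
   [(- q_i) ^ m]. *)
Definition sig_power (m : int) (j : nat) : mlaurent k 1 :=
  if (p%:Z %| m - j%:Z)%Z then (- lX k) ^ ((m - j%:Z) %/ p%:Z)%Z else 0.

Lemma oppr_lX_unit : - lX k \is a GRing.unit.
Proof. by rewrite unitrN; apply: lmono_unit. Qed.

(** At the special point, multiplication by - q_i is a cyclic shift of the coordinates, with a
    factor - X on wrapping around. As - X is a unit, the shift can be undone; the two directions
    serve the inductions on m upwards and downwards. *)
Lemma lsig_scompanion u m :
  (forall j, (j < p)%N -> sig (u j) = sig_power m j) <->
  (forall j, (j < p)%N -> sig (scompanion u j) = sig_power (m + 1) j).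
Proof.
have p0 : p%:Z != 0 by rewrite eqz_nat -lt0n.
have s0 : sig (scompanion u 0) = - lX k * sig (u p.-1).
  rewrite /= rmorphN rmorph_sum (bigD1 olast) //= big1 ?addr0.
    by rewrite rmorphM /= lsig_svar olastE eqxx mulrC mulNr.
  by move=> l ll; rewrite rmorphM /= lsig_svar eq_olast (negbTE ll) mulr0.
have powS j : sig_power (m + 1) j.+1 = sig_power m j.
  by rewrite /sig_power; have -> : m + 1 - j.+1%:Z = m - j%:Z by lia.
have pow0 : sig_power (m + 1) 0 = - lX k * sig_power m p.-1.
  rewrite /sig_power; have -> : m + 1 - 0%:Z = 1 * p%:Z + (m - p.-1%:Z) by lia.
  rewrite divzMDl // rpredDl ?dvdz_mull //.
  case: ifP => _; last by rewrite mulr0.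
  by rewrite exprzDr ?oppr_lX_unit // expr1z.
split=> h j jp.
  by case: j jp => [|j] jp; rewrite ?s0 ?pow0 ?powS -h // ?prednK // ltnW.
have [jl|jl] := eqVneq j p.-1.
  by apply: (mulrI oppr_lX_unit); have := h 0 p_gt0; rewrite s0 pow0 jl.
by rewrite -powS -(h j.+1) //; lia.
Qed.

(** Induction from m = 0, by [scompanion] upwards and by [scompanion_inv] downwards. Only the second
    divides by s_p, so the coordinates are power series for m >= 0. *)
Lemma minor_family (m : int) : exists u : nat -> S,
  [/\ forall i, minor_comb u i = (- q i) ^ m,
      0 <= m -> forall j, lval (u j) \in powser
    & forall j, (j < p)%N -> sig (u j) = sig_power m j].
Proof.
have qu i : - q i \is a GRing.unit by rewrite unitrN; apply: lmono_unit.
have up (n : nat) : exists u : nat -> S,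
  [/\ forall i, minor_comb u i = (- q i) ^ n,
      forall j, lval (u j) \in powser
    & forall j, (j < p)%N -> sig (u j) = sig_power n j].
  elim: n => [|n [u [uq upow usig]]].
    exists (fun j => (j == 0)%:R); split=> [i|j|j jp].
    - rewrite /minor_comb (bigD1 (Ordinal p_gt0)) //= big1 ?addr0 => [|j].
        by rewrite eminor0 rmorph1 mulr1 expr0z.
      case: j => -[//|j] jp _ /=; first by rewrite rmorph0 mul0r.
    - by case: (j == 0); rewrite ?rpred0 ?rpred1.
    rewrite /sig_power; case: j jp => [|j] jp; first by rewrite rmorph1 dvdz0 div0z.
    rewrite rmorph0; case: ifP => // /dvdzP[z hz].
    (* For 0 < j+1 < p, the integer - (j+1) is not a multiple z p, whatever the sign of z. *)
    have [z0|z0] : 0 <= z \/ z <= -1 by clear; lia.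
      by have := mulr_ge0 z0 (isT : 0 <= p%:Z); move: hz; clear; lia.
    by have := ler_wpM2r (isT : 0 <= p%:Z) z0; move: hz jp; clear; lia.
  exists (scompanion u); split=> [i|[|j]|].
  - by rewrite minor_comb_scompanion uq intS exprzDr ?qu // expr1z.
  - rewrite -[lval _]/(val (- \sum_(l < p) u l * svar l)) rmorphN rmorph_sum /=.
    by rewrite rpredN rpred_sum // => l _; rewrite rpredM //; apply: svar_subproof.
  - exact: upow.
  have -> : n.+1%:Z = n%:Z + 1 by clear; lia.
  exact: (proj1 (lsig_scompanion u n%:Z) usig).
case: m => [n|n]; first by have [u [uq upow usig]] := up n; exists u.
rewrite NegzE; elim: n.+1 => {n} [|n [u [uq upow usig]]].
  by have [u [uq upow usig]] := up 0; exists u; split=> // _; exact: upow.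
have e1 : - n.+1%:Z + 1 = - n%:Z by lia.
exists (scompanion_inv u); split=> [i|//|].
  apply: (mulrI (qu i)); rewrite -minor_comb_scompanion (minor_comb_eq _ (scompanionK _)).
  by rewrite uq -e1 exprzDr ?qu // expr1z mulrC.
apply: (proj2 (lsig_scompanion _ (- n.+1%:Z))) => j jp; rewrite scompanionK // e1; exact: usig.
Qed.

End Family.

(** * Infinite sums assembled by weight *)

Section Glue.
Variables (k : comNzRingType) (p : nat).
Hypothesis p_gt0 : (0 < p)%N.
Local Notation S := (lseries k p).
Local Notation E := {ffun 'I_p -> int}.
Local Notation q := (lvar k (n := p)).
Local Notation phi := (@lphi k p).
Local Notation sig := (@lsig k p p_gt0).

(** Only the finitely many negative indices above -N can need a bound below 0. *)
Lemma bounded_family (n : nat) (F : int -> mlaurent k n) (N : nat) :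
  (forall m, 0 <= m -> F m \in powser) ->
  exists K, forall m, - N%:Z <= m -> supp_in (bounded_by K) (F m).
Proof.
move=> Fp; elim: N => [|N [K hK]].
  by exists 0%N => m hm d h i; have /powserP/(_ d h i) := Fp m hm; rewrite oppr0.
exists (K + lbnd (F (- N.+1%:Z)))%N => m hm d h i.
move: h; have [-> h|ne h] := eqVneq m (- N.+1%:Z).
  by have := lbndP h i; zlia.
by have := hK m _ d h i; move: hm ne; zlia.
Qed.

Variables (Q j : nat) (c : int -> k) (F : int -> S).
Hypothesis Q_gt0 : (0 < Q)%N.

(** As M_j(i)^Q has degree Q j and (- q_i)^(Q m) has degree Q m, the weight Q (m - j) belongs to the
    index m, which it determines. *)
Definition glue_coef (w : int) (f : int -> k) : k :=
  if (Q%:Z %| w)%Z then c ((w %/ Q%:Z)%Z + j%:Z) * f ((w %/ Q%:Z)%Z + j%:Z) else 0.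

Lemma glue_coef_neq0 w f : glue_coef w f != 0 ->
  exists m, [/\ w = Q%:Z * (m - j%:Z), c m != 0 & f m != 0].
Proof.
rewrite /glue_coef; case: ifP => [Qw|]; last by rewrite eqxx.
set m := _ + _ => h; exists m; split.
- by rewrite /m addrK mulrC divzK.
- by apply: contraNneq h => ->; rewrite mul0r.
- by apply: contraNneq h => ->; rewrite mulr0.
Qed.

Lemma glue_coefE m f : glue_coef (Q%:Z * (m - j%:Z)) f = c m * f m.
Proof.
have Q0 : Q%:Z != 0 by rewrite eqz_nat -lt0n.
by rewrite /glue_coef dvdz_mulr // mulKz // subrK.
Qed.

Lemma glue_coef_ndvd w f : ~~ (Q%:Z %| w)%Z -> glue_coef w f = 0.
Proof. by rewrite /glue_coef => /negbTE ->. Qed.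

(* The weight-homogeneous components of [B] are those of the [c_m F_m], the
   one of weight [Q (m - j)] being taken from [c_m F_m]. *)
Definition is_glue (B : S) := forall e, lval B e = glue_coef (wt e) (fun m => lval (F m) e).

Lemma glue_exists (N : nat) : (forall m, m < - N%:Z -> c m = 0) ->
  (forall m, 0 <= m -> lval (F m) \in powser) ->
  exists2 B, is_glue B & (forall m, m < 0 -> c m = 0) -> lval B \in powser.
Proof.
move=> cN Fp; have [K hK] := bounded_family N Fp.
pose G : mlaurent k p := mklaurent (fun e => glue_coef (wt e) (fun m => lval (F m) e)).
have GE e : G e = glue_coef (wt e) (fun m => lval (F m) e).
  rewrite mklaurentE //; exists K => {}e /glue_coef_neq0[m [_ cm Fm]].
  apply: (hK m) Fm; rewrite leNgt; apply: contraNN cm => /cN ->; exact: eqxx.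
have GP : G \in powser_last.
  apply/powser_lastP => e; rewrite GE => /glue_coef_neq0[m [_ _ Fm]].
  exact: (lval_cone Fm).
exists (LSeries GP) => // c0; apply/powserP => e /=.
rewrite GE => /glue_coef_neq0[m [_ cm Fm]].
have : 0 <= m by rewrite leNgt; apply: contraNN cm => /c0 ->; exact: eqxx.
by move=> /Fp/powserP/(_ e Fm).
Qed.

(** A coefficient in degree [tdeg d] of the image only sees the exponents of weight [tdeg d], where
    [B] agrees with one c_m F_m. *)
Lemma lphi_glue B d : is_glue B ->
  phi B d = glue_coef (tdeg d) (fun m => phi (F m) d).
Proof.
move=> hB; pose m := (tdeg d %/ Q%:Z)%Z + j%:Z.
have [M1 h1] := lsubst_box (@lesym_evaluable k p) (ebound d) (lval_cone (F := B)).
have [M2 h2] := lsubst_box (@lesym_evaluable k p) (ebound d) (lval_cone (F := F m)).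
rewrite [LHS](h1 (M1 + M2)%N) ?leq_addr // /glue_coef.
rewrite [phi _ d](h2 (M1 + M2)%N) ?leq_addl //.
have [Qd|Qd] := boolP (Q%:Z %| tdeg d)%Z; last rewrite big1 // => e _.
  rewrite mulr_sumr; apply: eq_bigr => e _.
  have [->|ge] := eqVneq (gexp (@lesym p k) e d) 0; first by rewrite !mulr0.
  have [ec|ec] := pselect (last_cone e); last first.
    have z (H : S) : lval H e = 0.
      by apply/eqP; apply: contrapT => /negP /lval_cone.
    by rewrite !z !mul0r mulr0.
  have we := gexp_lesym_isobaric ec ge.
  by rewrite hB -we /glue_coef Qd -mulrA.
have [->|Be] := eqVneq (lval B e) 0; first by rewrite mul0r.
have [->|ge] := eqVneq (gexp (@lesym p k) e d) 0; first by rewrite !mulr0.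
have we := gexp_lesym_isobaric (lval_cone Be) ge.
by rewrite hB -we glue_coef_ndvd ?mul0r.
Qed.

Lemma wt_elast z : wt (elast p z) = p%:Z * z.
Proof.
rewrite /wt (bigD1 (olast p_gt0)) //= big1 ?addr0 => [|i il].
  by rewrite elastK ?olastE // prednK.
by rewrite ffunE (eq_olast p_gt0) (negbTE il) mulr0.
Qed.

Lemma lsig_glue B z : is_glue B ->
  sig B [ffun=> z] = glue_coef (p%:Z * z) (fun m => sig (F m) [ffun=> z]).
Proof.
by move=> hB; rewrite lsigE hB wt_elast /glue_coef; case: ifP; rewrite ?lsigE.
Qed.

End Glue.

Section GlueMul.
Variables (k : comNzRingType) (p : nat).
Hypothesis p_gt0 : (0 < p)%N.
Local Notation q := (lvar k (n := p)).
Variables (Q j : nat) (c : int -> k) (F : int -> lseries k p).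
Hypothesis Q_gt0 : (0 < Q)%N.

(** The F_m need not be homogeneous: in degree Q m, multiplication by a homogeneous [H] of degree Q
    j only uses the component of weight Q (m - j), which is the one kept in [B]. *)
Lemma glue_mul B (H : mlaurent k p) d : is_glue Q j c F B ->
    isobaric (Q%:Z * j%:Z) H ->
  (lphi B * H) d = glue_coef Q 0 c (tdeg d) (fun m => (lphi (F m) * H) d).
Proof.
move=> hB hH; rewrite [LHS](@lmul_box _ _ _ _ _ _ (leqnn _)).
have [/dvdzP[m hm]|Qd] := boolP (Q%:Z %| tdeg d)%Z; last first.
  rewrite glue_coef_ndvd // big1 // => b _.
  have [->|/hH] := eqVneq (H (d - b)) 0; first by rewrite mulr0.
  rewrite tdegD tdegN => hb; rewrite (lphi_glue _ hB) glue_coef_ndvd ?mul0r //.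
  apply: contraNN Qd => Qb; rewrite -(subrK (tdeg b) (tdeg d)) hb.
  by rewrite rpredD ?dvdz_mulr.
have {}hm : tdeg d = Q%:Z * (m - 0%:Z) by rewrite hm subr0 mulrC.
rewrite hm glue_coefE // -[_ * H]/(lmul _ _).
set N := (X in box _ X).
rewrite (@lmul_box _ _ _ _ _ (N + (lbnd (lphi (F m)) + lbnd H + ebound d))) ?leq_addl //.
have -> : \sum_(a <- box p N) lphi B a * H (d - a) = lmul (lphi B) H d.
  by rewrite (lmul_box (leqnn _)).
rewrite (@lmul_box _ _ _ _ _ (N + (lbnd (lphi (F m)) + lbnd H + ebound d))) ?leq_addr //.
rewrite mulr_sumr; apply: eq_bigr => b _.
have [->|/hH] := eqVneq (H (d - b)) 0; first by rewrite !mulr0.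
rewrite tdegD tdegN hm subr0 => hb.
have {}hb : tdeg b = Q%:Z * (m - j%:Z) by rewrite mulrBr -hb opprB subrKC.
by rewrite (lphi_glue _ hB) hb glue_coefE // mulrA.
Qed.

Lemma eminor_isobaric i : (j < p)%N -> isobaric j%:Z (eminor q i)`_j.
Proof.
elim: j => [|l IH] lp; first by rewrite eminor0; apply: isobaric1.
rewrite eminorS; apply: supp_inD.
  by rewrite (@epoly_lesym k p (Ordinal (ltnW lp))); apply: lesym_isobaric.
apply: supp_inN; rewrite intS; apply: isobaricM; last exact: IH (ltnW lp).
apply: supp_in_mono; rewrite /tdeg (bigD1 i) //= ffunE eqxx big1 ?addr0 // => a ai.
by rewrite ffunE (negbTE ai).
Qed.

End GlueMul.

Lemma expr_sum_pchar (A : comNzRingType) p t I (r : seq I) (P : pred I) (F : I -> A) :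
  p \in [pchar A] ->
  (\sum_(i <- r | P i) F i) ^+ (p ^ t) = \sum_(i <- r | P i) F i ^+ (p ^ t).
Proof.
move=> pA; have pp := pcharf_prime pA.
apply: (big_morph (fun x => x ^+ (p ^ t))) => [x y|].
  by apply: exprDn_pchar; rewrite pnatX (pnatE _ pp) pA.
by rewrite expr0n expn_eq0 -leqn0 leqNgt prime_gt0.
Qed.

Section Pchar.
Variables (k : comNzRingType) (p : nat).
Hypothesis pk : p \in [pchar k].

Lemma sumE n I (r : seq I) (P : pred I) (F : I -> mlaurent k n) d :
  (\sum_(i <- r | P i) F i) d = \sum_(i <- r | P i) F i d.
Proof. by elim/big_rec2: _ => // i x y _ <-. Qed.

Lemma mulrnE n (F : mlaurent k n) m d : (F *+ m) d = F d *+ m.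
Proof. by elim: m => // m IH; rewrite !mulrS addE IH. Qed.

Lemma pchar_mlaurent n : p \in [pchar mlaurent k n].
Proof.
rewrite inE (pcharf_prime pk); apply/eqP/mlaurent_eq => d.
by rewrite mulrnE mulrn_pchar.
Qed.

End Pchar.

Section GlueFamily.
Variables (k : fieldType) (p : nat).
Hypotheses (pk : p \in [pchar k]) (p_odd : odd p).
Let p_gt0 : (0 < p)%N := prime_gt0 (pcharf_prime pk).
Local Notation q := (lvar k (n := p)).
Local Notation sig := (@lsig k p p_gt0).

Lemma oppr_monoE n (a : {ffun 'I_n -> int}) z d :
  ((- lmono k a) ^ z) d = (-1) ^ z * (d == a *~ z)%:R.
Proof.
have e (m : nat) b : ((- lmono k b) ^+ m) d = (-1) ^+ m * (d == b *+ m)%:R.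
  rewrite (exprNn (lmono k b)) lmonoXn -signr_odd -[in RHS]signr_odd.
  by case: odd; rewrite ?expr1 ?expr0 ?mulN1r ?mul1r ?oppE monoE.
case: z => m; first exact: e.
rewrite NegzE -!exprz_inv invrN1 (invrN (lmono k a)) lmonoV -!exprnP e.
by rewrite mulrNz mulNrn.
Qed.

Lemma tdeg_lline (i : 'I_p) z : tdeg (lline i z) = z.
Proof.
rewrite /tdeg (bigD1 i) //= ffunE eqxx big1 ?addr0 // => l li.
by rewrite ffunE (negbTE li).
Qed.

Lemma llineE (i : 'I_p) z : [ffun j => (j == i)%:Z] *~ z = lline i z.
Proof.
by apply/ffunP => j; rewrite expMzE !ffunE; case: (j == i); rewrite ?mul1r ?mul0r.
Qed.

(** Here [A] is V^t g. The identity for [A] is checked degree by degree, where a single power of -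
    q_i is involved. The values under [sig] follow from [sig_power]. *)
Lemma glue_family t (g A : mlaurent k 1) (Q := (p ^ t)%N) :
  (forall z, A [ffun=> z] =
     if (Q%:Z %| z)%Z then g [ffun=> (z %/ Q%:Z)%Z] else 0) ->
  exists B : 'I_p -> lseries k p,
  [/\ forall i, \sum_(j < p) lphi (B j) * (eminor q i)`_j ^+ Q
        = lsubst (fun=> q i) A,
      forall j z, sig (B j) [ffun=> z] = if (Q%:Z %| z)%Z then
        (-1) ^+ j * g [ffun=> p%:Z * (z %/ Q%:Z)%Z + j%:Z] else 0
    & (forall m, m < 0 -> g [ffun=> m] = 0) -> forall j, lval (B j) \in powser].
Proof.
move=> AE; have Q_gt0 : (0 < Q)%N by rewrite expn_gt0 p_gt0.
have Q0 : Q%:Z != 0 by rewrite eqz_nat -lt0n.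
have p0 : p%:Z != 0 by rewrite eqz_nat -lt0n.
have Nu : (-1 : k) \is a GRing.unit by rewrite unitrN1.
have oQ : odd Q by rewrite oddX p_odd orbT.
have NQ (m : nat) z : odd m -> (-1 : k) ^ (z * m%:Z) = (-1) ^ z.
  by move=> om; rewrite mulrC -exprz_exp -exprnP -signr_odd om expr1.
have [u hu] := choice (minor_family k p_gt0).
(* The sign turns (- q_i)^(m Q) into q_i^(m Q), as Q is odd. *)
pose c (m : int) : k := (-1) ^ m * g [ffun=> m].
(* By Frobenius, the Q-th powers of the coordinates of (- q_i)^m are coordinates of its Q-th power
   along the M_j(i)^Q. The coefficients of g stay outside this power. *)
pose F (j : nat) m := u m j ^+ Q.
have Fp j m : 0 <= m -> lval (F j m) \in powser.
  move=> m0; have [_ /(_ m0 j) up _] := hu m.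
  by rewrite /F -[lval _]/(val (u m j ^+ Q)) rmorphXn rpredX.
have cN m : m < - (lbnd g)%:Z -> c m = 0.
  move=> hm; rewrite /c; suff -> : g [ffun=> m] = 0 by rewrite mulr0.
  apply/eqP; apply: contrapT => /negP /lbndP/(_ ord0); rewrite ffunE.
  by rewrite leNgt hm.
have ex j := glue_exists p_gt0 Q j cN (Fp j).
pose B (j : 'I_p) := s2val (cid2 (ex j)).
have hB (j : 'I_p) : is_glue Q j c (F j) (B j) by rewrite /B; case: (cid2 (ex j)).
exists B; split.
- move=> i; apply: mlaurent_eq => d; rewrite sumE lsubst_lvarE AE.
  have Mi (j : 'I_p) : isobaric (Q%:Z * j%:Z) ((eminor q i)`_j ^+ Q).
    by rewrite mulrC; apply: isobaricX; apply: eminor_isobaric.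
  under eq_bigr => j _ do rewrite (glue_mul Q_gt0 _ (hB j) (Mi j)).
  have [/dvdzP[m hm]|Qd] := boolP (Q%:Z %| tdeg d)%Z; last first.
    rewrite big1 => [|j _]; last by rewrite glue_coef_ndvd.
    case: eqP => // dd; rewrite ifN //; apply: contraNN Qd.
    by have -> : tdeg d = d i by rewrite {1}dd tdeg_lline.
  have {}hm : tdeg d = Q%:Z * (m - 0%:Z) by rewrite hm subr0 mulrC.
  under eq_bigr => j _ do rewrite hm glue_coefE // /F rmorphXn -exprMn.
  rewrite -mulr_sumr -sumE -expr_sum_pchar ?pchar_mlaurent //.
  have [/(_ i) uq _ _] := hu m; rewrite -[X in X ^+ _]/(minor_comb _ i) uq.
  rewrite exprnP exprz_exp oppr_monoE llineE NQ // /c mulrACA -expfzMl mulrNN mulr1 exp1rz mul1r.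
  have [->|dm] := eqVneq d (lline i (m * Q%:Z)).
    by rewrite ffunE eqxx eqxx dvdz_mull // mulzK // mulr1.
  rewrite mulr0; case: eqP => // dd; case/negP: dm; apply/eqP.
  by rewrite dd; congr lline; rewrite -(tdeg_lline i (d i)) -dd hm subr0 mulrC.
- move=> j z; rewrite (lsig_glue _ _ (hB j)).
  have sF m : sig (F j m) = sig_power k p m j ^+ Q.
    by have [_ _ us] := hu m; rewrite rmorphXn /= us.
  have [/dvdzP[w ->]|Qz] := boolP (Q%:Z %| z)%Z.
    rewrite mulzK //; pose m := p%:Z * w + j%:Z.
    have -> : p%:Z * (w * Q%:Z) = Q%:Z * (m - j%:Z) by rewrite /m addrK mulrA mulrC.
    rewrite glue_coefE // sF /sig_power.
    have -> : m - j%:Z = w * p%:Z by rewrite /m addrK mulrC.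
    rewrite dvdz_mull // mulzK // exprnP exprz_exp oppr_monoE.
    have -> : [ffun=> w * Q%:Z] = [ffun j : 'I_1 => (j == ord0)%:Z] *~ (w * Q%:Z).
      by apply/ffunP => l; rewrite expMzE !ffunE (ord1 l) mul1r.
    rewrite eqxx mulr1 NQ // /c mulrAC -exprzDr //; congr (_ * _).
    (* The total sign is (-1)^(m+w); it reduces to (-1)^j because p + 1 is even. *)
    have -> : m + w = w * p.+1%:Z + j%:Z by rewrite /m; clear; lia.
    rewrite exprzDr // [w * _]mulrC -exprz_exp -[(-1) ^ p.+1%:Z]exprnP.
    by rewrite -(signr_odd k p.+1) /= p_odd expr0 exp1rz mul1r.
  (* Q may divide p z without dividing z. Then m - j = p z / Q is not a multiple of p, and the
     coordinate vanishes. *)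
  rewrite /glue_coef; case: ifP => // /divzK h.
  rewrite sF /sig_power; case: ifP => [|_]; last first.
    by rewrite expr0n gtn_eqF // zeroE mulr0.
  rewrite addrK => /dvdzP[l hl]; case/negP: Qz.
  apply/dvdzP; exists l; apply: (mulfI p0).
  by rewrite -h hl mulrAC mulrC.
- move=> g0 j; rewrite /B; case: (cid2 (ex j)) => b _ /= hb; apply: hb => m m0.
  by rewrite /c g0 // mulr0.
Qed.

End GlueFamily.

(** * The operator delta on the elementary symmetric polynomials *)

(** First-order expansion. For N = p the remainder is divisible by p^2, so it still vanishes mod p
    after the division by p that defines delta. *)
Lemma prodr_add_mul (A : comNzRingType) (I : eqType) (a b : I -> A) (N : nat) (r : seq I) :
  uniq r -> exists c, \prod_(i <- r) (a i + b i *+ N) =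
    \prod_(i <- r) a i + (\sum_(i <- r) b i * \prod_(l <- r | l != i) a l) *+ N + c *+ (N * N).
Proof.
elim: r => [_|i r IH /= /andP[ir /IH[c e]]].
  by exists 0; rewrite !big_nil !mul0rn !addr0.
pose s := \sum_(l <- r) b l * \prod_(m <- r | m != l) a m.
exists (a i * c + b i * s + b i * c *+ N).
rewrite !big_cons eqxx e.
have -> : \prod_(l <- r | l != i) a l = \prod_(l <- r) a l.
  rewrite big_seq_cond [RHS]big_seq; apply: eq_bigl => l.
  by have [lr|] := boolP (l \in r); rewrite // (memPn ir).
have -> : \sum_(l <- r) b l * \prod_(m <- i :: r | m != l) a m = a i * s.
  rewrite mulr_sumr !big_seq; apply: eq_bigr => l lr.
  by rewrite big_cons eq_sym (memPn ir) // mulrCA.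
rewrite -/s; move: (\prod_(l <- r) a l) s => P s.
have natE (z : A) m : z *+ m = z * m%:R by rewrite mulr_natr.
rewrite (natE (b i)) (natE s) (natE c) (natE (b i * P + _)) (natE (b i * c)).
rewrite (natE (_ + b i * c * _)) natrM.
ring.
Qed.

Section IntegerEvaluation.

(** Identities between integer polynomials are transported to all the rings in use through [mev] and
    [rmorph_mev]. *)
Definition mev (A : comNzRingType) n (x : 'I_n -> A) : {mpoly int[n]} -> A :=
  mmap (intmul 1) x.

Variables (A : comNzRingType) (n : nat) (x : 'I_n -> A).

HB.instance Definition _ := GRing.RMorphism.copy (mev x)
  (mmap (intmul 1 : {rmorphism int -> A}) x).

Lemma mevX i : mev x 'X_i = x i.
Proof. by rewrite [LHS]mmapX mmap1U. Qed.

Lemma mev_mesym j : mev x (mesym n int j) = (epoly x)`_j.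
Proof. exact: mmap_mesym. Qed.

Lemma rmorph_mev (B : comNzRingType) (f : {rmorphism A -> B}) P :
  f (mev x P) = mev (f \o x) P.
Proof.
rewrite /mev /mmap rmorph_sum; apply: eq_bigr => m _.
rewrite rmorphM /= rmorph_int; congr (_ * _).
by rewrite /mmap1 rmorph_prod; apply: eq_bigr => i _; rewrite rmorphXn.
Qed.

Lemma eq_mev (y : 'I_n -> A) : x =1 y -> mev x =1 mev y.
Proof. by move=> xy P; rewrite (_ : x = y) //; apply/funext. Qed.

End IntegerEvaluation.

Lemma comp_mpoly_mev m n (t : n.-tuple {mpoly int[m]}) P :
  P \mPo t = mev (tnth t) P.
Proof.
rewrite /comp_mpoly /mev /mmap; apply: eq_bigr => d _; congr (_ * _).
by rewrite -[in LHS](intz (P@_d)) rmorph_int.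
Qed.

Lemma map_eminor (A B : comNzRingType) (f : {rmorphism A -> B}) n (x : 'I_n -> A) i :
  map_poly f (eminor x i) = eminor (f \o x) i.
Proof.
rewrite rmorph_prod; apply: eq_bigr => l _.
by rewrite rmorphD rmorph1 /= linearZ /= map_polyX.
Qed.

Lemma rmorph_epoly (A B : comNzRingType) (f : {rmorphism A -> B}) n (x : 'I_n -> A) j :
  f (epoly x)`_j = (epoly (f \o x))`_j.
Proof. by rewrite -map_epoly coef_map. Qed.

Lemma rmorph_eminor (A B : comNzRingType) (f : {rmorphism A -> B}) n (x : 'I_n -> A) i j :
  f (eminor x i)`_j = (eminor (f \o x) i)`_j.
Proof. by rewrite -map_eminor coef_map. Qed.

Lemma epoly_add (A : comNzRingType) n (x y : 'I_n -> A) (N j : nat) : exists c,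
  (epoly (fun i => x i + y i *+ N))`_j.+1 =
    (epoly x)`_j.+1 + (\sum_i y i * (eminor x i)`_j) *+ N + c *+ (N * N).
Proof.
have [c e] := prodr_add_mul (fun i => 1 + x i *: 'X) (fun i => y i *: 'X) N
  (index_enum_uniq 'I_n).
exists c`_j.+1.
have -> : epoly (fun i => x i + y i *+ N) = \prod_i (1 + x i *: 'X + y i *: 'X *+ N).
  by apply: eq_bigr => i _; rewrite scalerDl scalerMnl addrA.
rewrite e !coefD !coefMn coef_sum; congr (_ + _ *+ _ + _).
by apply: eq_bigr => i _; rewrite -scalerAl coefZ coefXM.
Qed.

Lemma mpoly_int_mulrIn n (P Q : {mpoly int[n]}) N : (0 < N)%N -> P *+ N = Q *+ N -> P = Q.
Proof.
move=> N0 PQ; apply/mpolyP => m; have := congr1 (mcoeff m) PQ.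
by rewrite !mcoeffMn => /eqP; rewrite eqr_pMn2r // => /eqP.
Qed.

Lemma eq_epoly (A : comNzRingType) n (x y : 'I_n -> A) : x =1 y -> epoly x = epoly y.
Proof. by move=> xy; apply: eq_bigr => i _; rewrite xy. Qed.

Lemma eq_eminor (A : comNzRingType) n (x y : 'I_n -> A) : x =1 y -> eminor x =1 eminor y.
Proof. by move=> xy i; apply: eq_bigr => l _; rewrite xy. Qed.

Section DeltaFormula.
Variable p : nat.
Hypothesis p_pr : prime p.
Let p_gt0 : (0 < p)%N := prime_gt0 p_pr.
Local Notation Z2 := {mpoly int[p + p]}.

Let q (i : 'I_p) : Z2 := 'X_(lshift p i).
Let q' (i : 'I_p) : Z2 := 'X_(rshift p i).

Lemma pdeltaSE (j : 'I_p) : pdeltaS j =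
  (epoly (fun i => q i ^+ p + q' i *+ p))`_j.+1 - (epoly q)`_j.+1 ^+ p.
Proof.
by rewrite /pdeltaS !comp_mpoly_mev !mev_mesym !(eq_epoly (tnth_mktuple _)).
Qed.

(** C_j as a polynomial in the q_i: setting q' = 0 in the integral delta S_(j+1) reuses the exact
    division by p already made there. *)
Definition frob_defect (j : 'I_p) : {mpoly int[p]} :=
  mev (fun i => match fintype.split i with inl a => 'X_a | inr _ => 0 end) (int_deltaS j).

Lemma frob_defectE (j : 'I_p) : frob_defect j *+ p =
  (epoly (fun i : 'I_p => 'X_i ^+ p))`_j.+1
  - (epoly (fun i : 'I_p => 'X_i))`_j.+1 ^+ p :> {mpoly int[p]}.
Proof.
rewrite /frob_defect -rmorphMn /= int_deltaSE // pdeltaSE rmorphB rmorphXn /= !rmorph_epoly.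
congr ((polyseq _)`__ - (polyseq _)`__ ^+ _); apply: eq_epoly => i /=; last first.
  by rewrite mevX (unsplitK (inl i)).
by rewrite rmorphD rmorphXn rmorphMn /= !mevX (unsplitK (inl i)) (unsplitK (inr i)) mul0rn addr0.
Qed.

Lemma epoly_perm (A : comNzRingType) n (x : 'I_n -> A) (s : {perm 'I_n}) :
  epoly (x \o s) = epoly x.
Proof. by rewrite /epoly [RHS](reindex_inj (@perm_inj _ s)). Qed.

(** p times the polynomial is visibly symmetric, and integer polynomials have no p-torsion. The
    fundamental theorem then gives C_j in terms of the S_i. *)
Lemma frob_defect_sym (j : 'I_p) : frob_defect j \is symmetric.
Proof.
apply/issymP => s; apply: (mpoly_int_mulrIn p_gt0).
have sX (i : 'I_p) : msym s 'X_i = 'X_(s i) :> {mpoly int[p]}.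
  rewrite msymX; congr 'X_[_]; apply/mnmP => l.
  rewrite multinomE tnth_mktuple !mnm1E; congr nat_of_bool.
  by apply/eqP/eqP => [->|<-]; rewrite ?permKV ?permK.
rewrite -rmorphMn /= frob_defectE rmorphB rmorphXn /= !rmorph_epoly.
rewrite -[epoly (fun i : 'I_p => 'X_i ^+ p : {mpoly int[p]})](epoly_perm _ s).
rewrite -[epoly (fun i : 'I_p => 'X_i : {mpoly int[p]})](epoly_perm _ s).
congr ((polyseq _)`__ - (polyseq _)`__ ^+ _); apply: eq_epoly => i /=; last exact: sX.
by rewrite rmorphXn /= sX.
Qed.

Definition frob_poly (j : 'I_p) : {mpoly int[p]} := sval (sym_fundamental (frob_defect_sym j)).

Lemma frob_polyE (j : 'I_p) :
  mev (fun i : 'I_p => mesym p int i.+1) (frob_poly j) = frob_defect j.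
Proof.
rewrite /frob_poly; case: sym_fundamental => t /= [<- _].
by rewrite comp_mpoly_mev; apply: eq_mev => i; rewrite tnth_mktuple.
Qed.

Lemma int_deltaS_expand (j : 'I_p) : exists c, int_deltaS j =
  mev q (frob_defect j) + \sum_i q' i * (eminor (fun i => q i ^+ p) i)`_j + c *+ p.
Proof.
have [c e] := epoly_add (fun i => q i ^+ p) q' p j.
exists c; apply: (mpoly_int_mulrIn p_gt0).
have md : mev q (frob_defect j) *+ p =
    (epoly (fun i => q i ^+ p))`_j.+1 - (epoly q)`_j.+1 ^+ p.
  rewrite -rmorphMn /= frob_defectE rmorphB rmorphXn /= !rmorph_epoly.
  congr ((polyseq _)`__ - (polyseq _)`__ ^+ _); apply: eq_epoly => i /=; last exact: mevX.
  by rewrite rmorphXn /= mevX.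
rewrite int_deltaSE // pdeltaSE e !mulrnDl md -mulrnA.
rewrite addrAC; congr (_ + _); exact: addrAC.
Qed.

Variable k : comNzRingType.
Hypothesis pk : p \in [pchar k].
Local Notation L := (mlaurent k p).

Definition frob_series (j : 'I_p) : lseries k p := mev (svar k (p := p)) (frob_poly j).

(** Mod p, the minors of the q_i^p become the p-th powers of the minors of the q_i. *)
Lemma deltaS_expand (j : 'I_p) : deltaS k j =
  (lphi (frob_series j))%:MP
  + \sum_i ((eminor (lvar k (n := p)) i)`_j ^+ p)%:MP * 'X_i.
Proof.
have pL : p \in [pchar {mpoly L[p]}].
  rewrite inE p_pr -(rmorph_nat (@mpolyC p L)).
  by rewrite (pcharf0 (pchar_mlaurent pk p)) rmorph0 /=.
have [c e] := int_deltaS_expand j.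
pose th (i : 'I_(p + p)) : {mpoly L[p]} :=
  match fintype.split i with inl a => (lvar k a)%:MP | inr b => 'X_b end.
have thq i : mev th (q i) = (lvar k i)%:MP by rewrite mevX /th (unsplitK (inl i)).
have thq' i : mev th (q' i) = 'X_i by rewrite mevX /th (unsplitK (inr i)).
rewrite [LHS]/(mev th (int_deltaS j)) e !rmorphD rmorphMn /=.
rewrite -[X in _ + X]mulr_natr (pcharf0 pL) mulr0 addr0; congr (_ + _).
  transitivity (mev (fun i : 'I_p => (lesym k i)%:MP : {mpoly L[p]}) (frob_poly j)).
    rewrite -frob_polyE (rmorph_mev _ (mev q)) (rmorph_mev _ (mev th)).
    apply: eq_mev => i /=; rewrite !mev_mesym -epoly_lesym !rmorph_epoly.
    by congr ((polyseq _)`__); apply: eq_epoly => l /=; rewrite thq.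
  rewrite /frob_series (rmorph_mev _ (@lphi k p)) (rmorph_mev _ (@mpolyC p L)).
  by apply: eq_mev => i /=; rewrite lphi_svar.
rewrite (rmorph_sum (mev th)) /=; apply: eq_bigr => i _; rewrite (rmorphM (mev th)) /= thq' mulrC; congr (_ * _).
rewrite rmorph_eminor rmorphXn /= rmorph_eminor -(pFrobenius_autE pL) rmorph_eminor.
congr ((polyseq _)`__); apply: eq_eminor => l /=.
by rewrite rmorphXn /= thq pFrobenius_autE.
Qed.

End DeltaFormula.

(** * The value of C_j at the special point *)

Section FrobeniusDefect.
Variable p : nat.
Hypotheses (p_pr : prime p) (p_odd : odd p).
Let p_gt0 : (0 < p)%N := prime_gt0 p_pr.

Lemma epoly_const (A : comNzRingType) n (x : A) j :
  (epoly (fun _ : 'I_n => x))`_j = x ^+ j *+ 'C(n, j).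
Proof.
rewrite coef_epoly -[in RHS](card_ord n) -card_draws -sumr_const.
rewrite [RHS](eq_bigl (fun h : {set 'I_n} => #|h| == j)) => [|h]; last by rewrite !inE.
by apply: eq_bigr => h /eqP <-; rewrite prodr_const.
Qed.

Lemma epoly_scale (A : comNzRingType) n (a : A) (x : 'I_n -> A) j :
  (epoly (fun i => a * x i))`_j = a ^+ j * (epoly x)`_j.
Proof.
rewrite !coef_epoly mulr_sumr; apply: eq_bigr => h /eqP <-.
by rewrite big_split /= prodr_const.
Qed.

Lemma epoly_last (A : comNzRingType) n (x : 'I_n -> A) : (epoly x)`_n = \prod_i x i.
Proof.
rewrite coef_epoly (big_pred1 [set: 'I_n]) => [|h].
  by apply: eq_bigl => i; rewrite inE.
rewrite /= eqEcard finset.subsetT /= cardsT card_ord eqn_leq.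
by have := max_card h; rewrite card_ord => ->.
Qed.

Section RootOfUnity.
Variables (F : fieldType) (z : F).
Hypothesis hz : p.-primitive_root z.
Let q (i : 'I_p) : {poly F} := (z ^+ i)%:P * 'X.

(* Multiplication by [z] permutes the [q_i], so [(z ^ j - 1) e_j(q) = 0]. *)
Lemma epoly_unity_root j : (0 < j < p)%N -> (epoly q)`_j = 0.
Proof.
case/andP=> j0 jp; have zj : z ^+ j != 1.
  by rewrite -(prim_order_dvd hz) gtnNdvd.
have e : epoly (fun i => z%:P * q i) = epoly q.
  rewrite /epoly [RHS](reindex_inj (@ordS_inj p)); apply: eq_bigr => i _.
  by rewrite /q /= mulrA -polyCM -exprS -(prim_expr_mod hz i.+1).
have := epoly_scale z%:P q j; rewrite e => /eqP.
rewrite -subr_eq0 -{1}[(epoly q)`_j]mul1r -mulrBl mulf_eq0 => /orP[|/eqP //].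
by rewrite -polyC_exp -polyC1 -polyCB polyC_eq0 subr_eq0 eq_sym (negbTE zj).
Qed.

Lemma epoly_unity_root_last : (epoly q)`_p = 'X^p.
Proof.
rewrite epoly_last big_split /= prodr_const card_ord.
rewrite -(rmorph_prod (@polyC F)) /= -expr_sum.
(* The exponent 0 + ... + (p-1) of z is binomial(p, 2), a multiple of p because p > 2. *)
have -> : (\sum_(i < p) i)%N = 'C(p, 2) by rewrite -(big_mkord xpredT id) bin2_sum.
have p2 : (2 < p)%N by move: p_pr p_odd; case: p => [|[|[|]]].
have /dvdnP[m ->] := prime_dvd_bin p_pr (p2 : (0 < 2 < p)%N).
by rewrite mulnC exprM (prim_expr_order hz) expr1n polyC1 mul1r.
Qed.

Lemma epoly_unity_rootE (j : 'I_p) :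
  (epoly q)`_j.+1 = if j.+1 == p then 'X^p else 0.
Proof.
case: eqP => [->|/eqP jp]; first exact: epoly_unity_root_last.
by rewrite epoly_unity_root //= ltn_neqAle jp ltn_ord.
Qed.

Lemma epoly_unity_rootX j :
  (epoly (fun i => q i ^+ p))`_j = 'X^(p * j) *+ 'C(p, j).
Proof.
rewrite exprM -epoly_const; congr ((polyseq _)`__); apply: eq_epoly => i.
by rewrite /q exprMn -polyC_exp -exprM mulnC exprM (prim_expr_order hz) expr1n polyC1 mul1r.
Qed.

End RootOfUnity.

(** The value is 0 at j+1 = p because S_p is a monomial, so that S_p(q^p) = S_p(q)^p. *)
Definition frob_const (j : nat) : nat := (if j.+1 == p then 0 else 'C(p, j.+1) %/ p)%N.

Lemma frob_constE (j : 'I_p) : (p * frob_const j = 'C(p, j.+1) - (j.+1 == p))%N.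
Proof.
rewrite /frob_const; case: eqP => [->|/eqP jp]; first by rewrite muln0 binn.
rewrite subn0 mulnC divnK // prime_dvd_bin //= ltn_neqAle jp.
exact: ltn_ord.
Qed.

Lemma frob_poly_spec (j : 'I_p) :
  mev (fun i : 'I_p => if i.+1 == p then 'X else 0 : {poly int}) (frob_poly p_pr j)
  = 'X^(j.+1) *+ frob_const j.
Proof.
set P := mev _ _; have [z hz] := C_prim_root_exists p_gt0.
pose q (i : 'I_p) : {poly algC} := (z ^+ i)%:P * 'X.
(* For q_i = z^i X the last elementary symmetric polynomial is X^p, whence the substitution of X^p
   for X. It is undone at the end by reading the coefficients of index p l. *)
pose f : {rmorphism {poly int} -> {poly algC}} :=
  comp_poly 'X^p \o map_poly (intmul 1 : {rmorphism int -> algC}).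
have fP : f P *+ p = 'X^(p * j.+1) *+ (p * frob_const j).
  have -> : f P = mev q (frob_defect j).
    rewrite -frob_polyE (rmorph_mev _ (mev q)) /P (rmorph_mev _ f).
    apply: eq_mev => i /=; rewrite mev_mesym epoly_unity_rootE //; case: ifP => _; last by rewrite !rmorph0.
    by rewrite map_polyX comp_polyX.
  rewrite -rmorphMn /= frob_defectE // rmorphB rmorphXn /= !rmorph_epoly.
  rewrite (@eq_epoly _ _ _ (fun i => q i ^+ p)) => [|l /=]; last by rewrite rmorphXn /= mevX.
  rewrite [in X in _ - X](@eq_epoly _ _ _ q) => [|l /=]; last by rewrite mevX.
  rewrite epoly_unity_rootX // epoly_unity_rootE // frob_constE.
  have [jp|jp] := eqVneq j.+1 p; last by rewrite expr0n gtn_eqF // !subr0 subn0.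
  by rewrite jp binn mulr1n exprM subrr subnn mulr0n.
apply/polyP => l; have := congr1 (fun r : {poly algC} => r`_(p * l)) fP.
rewrite /f /= !coefMn coef_comp_poly_Xn // dvdn_mulr // mulKn // coef_map /=.
rewrite !coefXn eqn_pmul2l // => /eqP.
rewrite mulnC mulrnA eqr_pMn2r // => /eqP e.
by apply: (@intr_inj algC); rewrite e rmorphMn /= rmorph_nat.
Qed.

Variable k : comNzRingType.
Hypothesis pk : p \in [pchar k].

Lemma lsig_frob_series (j : 'I_p) :
  @lsig k p p_gt0 (frob_series p_pr k j) = lX k ^+ j.+1 *+ frob_const j.
Proof.
pose f : {rmorphism {poly int} -> mlaurent k 1} :=
  horner_eval (lX k) \o map_poly (intmul 1 : {rmorphism int -> mlaurent k 1}).
have fX : f 'X = lX k by rewrite /f /= map_polyX /horner_eval hornerX.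
have -> : lX k ^+ j.+1 *+ frob_const j = f ('X^(j.+1) *+ frob_const j).
  by rewrite rmorphMn rmorphXn fX.
rewrite -frob_poly_spec /frob_series.
rewrite (rmorph_mev _ (@lsig k p p_gt0)) (rmorph_mev _ f).
by apply: eq_mev => i; rewrite /= lsig_svar; case: ifP; rewrite ?rmorph0.
Qed.

(** Pascal's rule: two consecutive values of binomial(p-1, j) add up to a binomial(p, j+1) divisible
    by p. *)
Lemma bin_pchar j : (j < p)%N -> 'C(p.-1, j)%:R = (-1) ^+ j :> k.
Proof.
elim: j => [|j IH] jp; first by rewrite bin0.
have := binS p.-1 j; rewrite prednK // => /(congr1 (fun m => m%:R : k)).
have /dvdnP[m ->] := prime_dvd_bin p_pr (jp : (0 < j.+1 < p)%N).
rewrite natrM (pcharf0 pk) mulr0 natrD IH 1?ltnW // => /eqP.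
by rewrite eq_sym addr_eq0 => /eqP ->; rewrite exprS mulN1r.
Qed.

(** Thus [frob_const p j] is (-1)^j/(j+1) in k, the origin of the denominators in phi^(-1). *)
Lemma frob_const_pchar (j : 'I_p) : j.+1 != p ->
  j.+1%:R * (frob_const j)%:R = (-1) ^+ j :> k.
Proof.
move=> jp; rewrite -bin_pchar // -natrM; congr _%:R; apply/eqP.
rewrite -(eqn_pmul2l p_gt0) mulnCA frob_constE (negbTE jp) subn0.
by rewrite mul_bin_diag.
Qed.

End FrobeniusDefect.

(** * Injectivity of the symmetrization map *)

Lemma rmorph_mmap (R A B : comNzRingType) (h : {rmorphism A -> B}) (f : R -> A) n
  (x : 'I_n -> A) P : h (mmap f x P) = mmap (h \o f) (h \o x) P.
Proof.
rewrite /mmap rmorph_sum; apply: eq_bigr => m _; rewrite rmorphM; congr (_ * _).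
by rewrite /mmap1 rmorph_prod; apply: eq_bigr => i _; rewrite rmorphXn.
Qed.

Lemma eq_mmap (R A : comNzRingType) (f g : R -> A) n (x y : 'I_n -> A) :
  f =1 g -> x =1 y -> mmap f x =1 mmap g y.
Proof.
move=> fg xy P; rewrite /mmap; apply: eq_bigr => m _; rewrite fg; congr (_ * _).
by apply: eq_bigr => i _; rewrite xy.
Qed.

(** * The map on coefficients is injective *)

Section Constants.
Variables (k : comNzRingType) (n : nat).
Local Notation E := {ffun 'I_n -> int}.

Lemma lconst_bounded (c : k) : `[< lower_bounded (fun d : E => c *+ (d == 0)) >].
Proof.
apply/asboolP; exists 0%N => d; case: (eqVneq d 0) => [->|_]; last by rewrite mulr0n eqxx.
by move=> _ i; rewrite ffunE.
Qed.

Definition lconst (c : k) : mlaurent k n := MLaurent (lconst_bounded c).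

Lemma lconstM_coef c (G : mlaurent k n) d : (lconst c * G) d = c * G d.
Proof.
rewrite (@mulE_supp _ _ _ _ _ [:: 0]) // ?big_seq1 /= ?eqxx ?subr0 // => a.
by rewrite inE => /negbTE ->; rewrite mulr0n mul0r.
Qed.

Lemma lconst_zmod : zmod_morphism lconst.
Proof. by move=> a b; apply: mlaurent_eq => d; rewrite addE oppE /= mulrnBl. Qed.

Lemma lconst_monoid : monoid_morphism lconst.
Proof.
split=> [|a b]; apply: mlaurent_eq => d; first by [].
by rewrite lconstM_coef /= mulrnAr.
Qed.

HB.instance Definition _ := GRing.isZmodMorphism.Build _ _ lconst lconst_zmod.
HB.instance Definition _ := GRing.isMonoidMorphism.Build _ _ lconst lconst_monoid.

Definition mnm_exp (m : 'X_{1..n}) : E := [ffun i => (m i)%:Z].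

Lemma mnm_exp_inj : injective mnm_exp.
Proof. by move=> m m' /ffunP h; apply/mnmP => i; have := h i; rewrite !ffunE => -[]. Qed.

Definition mpoly_series : {mpoly k[n]} -> mlaurent k n := mmap lconst (lvar k (n := n)).

HB.instance Definition _ := GRing.RMorphism.copy mpoly_series (mmap lconst (lvar k (n := n))).

Lemma mmap1_gexp l (g : 'I_n -> mlaurent k l) m : mmap1 g m = gexp g (mnm_exp m).
Proof. by apply: eq_bigr => i _; rewrite ffunE. Qed.

Lemma gexp_lvar_id (e : E) : gexp (lvar k (n := n)) e = lmono k e.
Proof.
rewrite /gexp; under eq_bigr do rewrite lmonoXz.
rewrite lmono_prod; congr lmono; apply/ffunP => j.
rewrite sum_ffunE (bigD1 j) //= big1 ?addr0; last first.
  by move=> i ij; rewrite expMzE ffunE eq_sym (negbTE ij) mul0r.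
by rewrite expMzE ffunE eqxx mul1r.
Qed.

Lemma mpoly_series_coef P m : mpoly_series P (mnm_exp m) = P@_m.
Proof.
rewrite /mpoly_series /mmap sumE; under eq_bigr => i _ do
  rewrite mmap1_gexp gexp_lvar_id lconstM_coef monoE (inj_eq mnm_exp_inj).
have [mP|mP] := boolP (m \in msupp P).
  rewrite (bigD1_seq m) //= eqxx mulr1 big1 ?addr0 // => i im.
  by rewrite eq_sym (negbTE im) mulr0.
rewrite memN_msupp_eq0 // big_seq big1 // => i iP.
by rewrite eq_sym (negbTE (memPn mP i iP)) mulr0.
Qed.

Lemma mpoly_series_eq0 P : mpoly_series P = 0 -> P = 0.
Proof.
by move=> P0; apply/mpolyP => m; rewrite -mpoly_series_coef P0 zeroE mcoeff0.
Qed.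

End Constants.

Section PhiInjective.
Variables (k : comNzRingType) (p : nat).
Hypothesis p_gt0 : (0 < p)%N.
Local Notation phi := (@lphi k p).

(** Polynomials embed in series, which reduces this to the algebraic independence of the elementary
    symmetric polynomials. *)
Lemma mmap_lesym_eq0 (P : {mpoly k[p]}) : mmap (@lconst k p) (@lesym p k) P = 0 -> P = 0.
Proof.
move=> P0; apply: msym_fundamental_un0; apply: mpoly_series_eq0.
rewrite -P0 /comp_mpoly (rmorph_mmap (@mpoly_series k p)).
apply: eq_mmap => [c|i] /=; first by rewrite /mpoly_series mmapC.
by rewrite tnth_mktuple /mpoly_series mmap_mesym epoly_lesym.
Qed.

(** The component of [F] of the weight of [e0] has finitely many exponents. Multiplied by s_p^N it
    is a polynomial P, and P(S) is S_p^N times the homogeneous component of that degree of the image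
    of [F], which is 0. *)
Lemma lphi_eq0 (F : lseries k p) : phi F = 0 -> F = 0.
Proof.
move=> F0; apply: val_inj; apply: mlaurent_eq => e0; change (lval F e0 = 0).
apply/eqP; apply: contrapT => /negP Fe0.
pose w := wt e0; pose N := lbnd (lval F).
pose K := (absz w + p * (p * N) + N)%N.
pose good (e : {ffun 'I_p -> int}) := (lval F e != 0) && (wt e == w).
have goodK e : good e -> e \in box p K.
  case/andP=> Fe /eqP we; rewrite mem_box; apply/forallP => i.
  by apply: wt_bound; [exact: lbndP | rewrite we abszE].
(* On the cone only the last coordinate can be negative, and it is at least -N. *)
pose mon (e : {ffun 'I_p -> int}) : 'X_{1..p} :=
  [multinom absz (e i + (N * (i == olast p_gt0))%N%:Z)%R | i < p].
have monE e : good e -> mnm_exp (mon e) = e + [ffun i => (N * (i == olast p_gt0))%N%:Z].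
  case/andP=> Fe _; apply/ffunP => i; rewrite !ffunE mnmE gez0_abs //.
  have := lval_cone Fe (i := i); rewrite (eq_olast p_gt0).
  case: eqP => [_ _|_ /(_ isT)]; last by rewrite muln0 addr0.
  by have := lbndP Fe i; rewrite muln1 -/N; clear; zlia.
pose P : {mpoly k[p]} := \sum_(e <- box p K | good e) lval F e *: 'X_[mon e].
pose H := \sum_(e <- box p K | good e) lconst p (lval F e) * gexp (@lesym p k) e.
have H0 : H = 0.
  apply: mlaurent_eq => d; rewrite zeroE sumE.
  under eq_bigr do rewrite lconstM_coef.
  have [dw|dw] := eqVneq (tdeg d) w; last first.
    rewrite big1 // => e /andP[Fe /eqP we].
    apply/eqP; apply: contraNT dw => h.
    have ge : gexp (@lesym p k) e d != 0 by apply: contraNneq h => ->; rewrite mulr0.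
    by rewrite (gexp_lesym_isobaric (lval_cone Fe) ge) we.
  have := congr1 (fun G : mlaurent k p => G d) F0.
  rewrite zeroE [phi F d](lsubstE (@lesym_evaluable k p)); last exact: lval_cone.
  have nz e : lval F e * gexp (@lesym p k) e d != 0 -> good e.
    move=> h; have Fe : lval F e != 0 by apply: contraNneq h => ->; rewrite mul0r.
    have ge : gexp (@lesym p k) e d != 0 by apply: contraNneq h => ->; rewrite mulr0.
    by rewrite /good Fe -dw (gexp_lesym_isobaric (lval_cone Fe) ge) eqxx.
  rewrite (@fsum_box _ _ _ K) => [{2}<-|e /nz/goodK]; last first.
    by rewrite mem_box => /forallP.
  rewrite big_mkcond; apply: eq_bigr => e _; case: ifP => // /negbT ng.
  by apply/esym/eqP; apply: contraNT ng => /nz.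
have P0 : P = 0.
  apply: mmap_lesym_eq0; rewrite raddf_sum /=.
  transitivity (gexp (@lesym p k) [ffun i => (N * (i == olast p_gt0))%N%:Z] * H);
    last by rewrite H0 mulr0.
  rewrite /H mulr_sumr; apply: eq_bigr => e ge.
  rewrite mmapZ mmapX mmap1_gexp monE // (gexpD (@lesym_evaluable k p)).
  - by rewrite [RHS]mulrC mulrA.
  - by case/andP: ge => Fe _; apply: (lval_cone Fe).
  - by move=> i _; rewrite ffunE.
have g0 : good e0 by rewrite /good Fe0 eqxx.
have := congr1 (mcoeff (mon e0)) P0; rewrite mcoeff0 raddf_sum /=.
rewrite big_mkcond (bigD1_seq e0) ?goodK ?box_uniq //= g0 mcoeffZ mcoeffX eqxx mulr1.
rewrite big1 ?addr0 => [F00|e ne]; first by rewrite F00 eqxx in Fe0.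
case: ifP => // ge.
rewrite mcoeffZ mcoeffX; case: eqP => [h|_]; last by rewrite mulr0.
case/eqP: ne; apply: (@addIr _ [ffun i => (N * (i == olast p_gt0))%N%:Z]).
by rewrite -!monE // h.
Qed.

End PhiInjective.

Lemma mmap_map_mpoly (R S A : comNzRingType) (f : {rmorphism R -> S}) n (h : S -> A)
    (x : 'I_n -> A) P : injective f ->
  mmap h x (map_mpoly f P) = mmap (h \o f) x P.
Proof.
move=> f_inj; rewrite /mmap (perm_big _ (msupp_map_mpoly _ f_inj)) /=.
by apply: eq_bigr => m _; rewrite mcoeff_map_mpoly.
Qed.

(** * Affine substitutions with regular determinant *)

Section AffineSubstitution.
Variables (A : comNzRingType) (n : nat).
Local Notation P := {mpoly A[n]}.
Local Notation msubst x := (mmap (@mpolyC n A) x).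
Implicit Types (x y : 'I_n -> P).

Lemma msubst_comp x y F : msubst y (msubst x F) = msubst (fun i => msubst y (x i)) F.
Proof.
rewrite (rmorph_mmap (msubst y : {rmorphism P -> P})).
by apply: eq_mmap => c //=; rewrite mmapC.
Qed.

Lemma msubst_id F : msubst (fun i => 'X_i) F = F.
Proof.
rewrite [RHS]mpolyE; apply: eq_bigr => m _.
by rewrite mmap1_id mul_mpolyC.
Qed.

Lemma msubst_scale_inj (c : A) F : GRing.lreg c ->
  msubst (fun i => c *: 'X_i) F = 0 -> F = 0.
Proof.
move=> c_reg F0; apply/mpolyP => m; rewrite mcoeff0.
have e : msubst (fun i => c *: 'X_i) F =
    \sum_(m <- msupp F) (F@_m * c ^+ mdeg m) *: 'X_[m].
  apply: eq_bigr => l _; rewrite -scalerA mul_mpolyC; congr (_ *: _).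
  rewrite /mmap1 mpolyXE_id mdegE expr_sum -scaler_prod.
  by apply: eq_bigr => i _; rewrite exprZn.
have := congr1 (mcoeff m) F0; rewrite e mcoeff0 raddf_sum /=.
under eq_bigr => l _ do rewrite mcoeffZ mcoeffX.
have [mF|mF _] := boolP (m \in msupp F); last exact: memN_msupp_eq0.
rewrite (bigD1_seq m) //= eqxx mulr1 big1 ?addr0 => [|l lm]; last first.
  by rewrite (negbTE lm) mulr0.
by rewrite mulrC => /eqP; rewrite mulrI_eq0 => [/eqP|]; last exact: lregX.
Qed.

(** The matrix need not be invertible: composing with its adjugate leaves a translation and the
    scaling by the determinant, and the scaling multiplies a coefficient of degree d by a regular
    d-th power. *)
Lemma msubst_affine_inj (t : 'I_n -> 'I_n -> A) (b : 'I_n -> A) F :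
    GRing.lreg (\det (\matrix_(j, i) t j i)) ->
  msubst (fun j => (b j)%:MP + \sum_i (t j i)%:MP * 'X_i) F = 0 -> F = 0.
Proof.
set T := \matrix_(j, i) t j i => T_reg F0.
pose adj i : P := \sum_l (\adj T i l)%:MP * 'X_l.
have : msubst (fun j => (b j)%:MP + \det T *: 'X_j) F = 0.
  have := congr1 (msubst adj) F0; rewrite msubst_comp rmorph0 => <-.
  apply: eq_mmap => // j; rewrite rmorphD /= mmapC; congr (_ + _).
  rewrite raddf_sum /=.
  under eq_bigr => i _ do rewrite rmorphM /= mmapC mmapX mmap1U /adj mulr_sumr.
  rewrite exchange_big /=.
  under eq_bigr => l _ do under eq_bigr => i _ do rewrite mulrA -mpolyCM.
  under eq_bigr => l _ do rewrite -mulr_suml -(raddf_sum (@mpolyC n A)) /=.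
  have mulE l : \sum_i t j i * \adj T i l = (\det T) *+ (j == l).
    have /matrixP/(_ j l) := mul_mx_adj T; rewrite !mxE => <-.
    by apply: eq_bigr => i _; rewrite !mxE.
  rewrite (bigD1 j) //= mulE eqxx mulr1n big1 ?addr0 => [|l lj].
    by rewrite mul_mpolyC.
  by rewrite mulE eq_sym (negbTE lj) mulr0n mpolyC0 mul0r.
pose tr (c : 'I_n -> A) i : P := 'X_i + (c i)%:MP.
move=> F1; have : msubst (fun j => \det T *: 'X_j) (msubst (tr b) F) = 0.
  rewrite msubst_comp -[RHS]F1; apply: eq_mmap => // j.
  by rewrite rmorphD /= mmapX mmap1U mmapC addrC.
move/(msubst_scale_inj T_reg)/(congr1 (msubst (tr (fun i => - b i)))).
rewrite msubst_comp rmorph0 -[X in _ -> X = _]msubst_id => <-.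
apply: eq_mmap => // j.
by rewrite rmorphD /= mmapX mmap1U mmapC /tr -addrA -mpolyCD addNr addr0.
Qed.

End AffineSubstitution.

Section SymInjective.
Variables (k : fieldType) (p : nat).
Hypotheses (p_pr : prime p) (pk : p \in [pchar k]).
Let p_gt0 : (0 < p)%N := prime_gt0 p_pr.
Local Notation L := (mlaurent k p).
Local Notation q := (lvar k (n := p)).
Local Notation S := (lseries k p).
Local Notation phi := (@lphi k p).

(** If q_i f = q_j f, the coefficients of f are invariant under raising the exponent of q_i and
    lowering that of q_j. A nonzero one would make the support unbounded below. *)
Lemma lvar_sub_lreg (i j : 'I_p) : i != j -> GRing.lreg (q i - q j).
Proof.
move=> ij; apply: mulrI0_lreg => f; rewrite mulrBl => /eqP; rewrite subr_eq0 => /eqP h.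
pose u (l : 'I_p) : {ffun 'I_p -> int} := [ffun j => (j == l)%:Z].
have step d : f d = f (d + u i - u j).
  have := congr1 (fun g : L => g (d + u i)) h.
  by rewrite [LHS]lmul_monol [RHS]lmul_monol addrK.
have steps n d : f d = f (d + (u i - u j) *+ n).
  elim: n d => [|n IH] d; first by rewrite mulr0n addr0.
  by rewrite step IH mulrS !addrA.
apply: mlaurent_eq => d; rewrite zeroE; apply/eqP; apply: contrapT => /negP fd.
have := fd; rewrite (steps (absz (d j) + lbnd f).+1) => /lbndP/(_ j).
rewrite pmulrn !ffunE ffunMzE !ffunE eqxx eq_sym (negbTE ij) mulrzz.
by move: (d j) (lbnd f); clear => z N; lia.
Qed.

Lemma eminor_det_lreg :
  GRing.lreg (\det (\matrix_(j < p, i < p) (eminor q i)`_j : 'M[L]_p)).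
Proof.
set T := \matrix_(_, _) _.
have [u hu] := choice (minor_family k p_gt0).
pose U : 'M[L]_p := \matrix_(m, j) phi (u (m : nat)%:Z j).
have UT : U *m T = Vandermonde p (\row_i (- q i)).
  apply/matrixP => m i; rewrite !mxE; have [/(_ i) e _ _] := hu (m : nat)%:Z; rewrite exprnP -e.
  by apply: eq_bigr => j _; rewrite !mxE.
apply: (@GRing.lregMl _ (\det U)); rewrite -det_mulmx UT det_Vandermonde.
apply: ssrcomplements.lreg_prod => i _ _; apply: ssrcomplements.lreg_prod => j _ ij.
rewrite !mxE opprK addrC; apply: lvar_sub_lreg.
by apply: contraTneq ij => ->; rewrite ltnn.
Qed.

(** With coefficients in [lseries], [sym_map] becomes a ring morphism; [sym_map_val] relates the
    two. *)
Definition sym_lift : {mpoly S[p]} -> {mpoly L[p]} :=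
  mmap (@mpolyC p L \o phi) (@deltaS p k).

HB.instance Definition _ := GRing.RMorphism.copy sym_lift
  (mmap (@mpolyC p L \o phi) (@deltaS p k)).

Definition val_mpoly : {mpoly S[p]} -> {mpoly L[p]} := map_mpoly (val : S -> L).

Lemma sym_map_val (F : {mpoly S[p]}) : sym_map (val_mpoly F) = sym_lift F.
Proof. by rewrite /val_mpoly /sym_map (@mmap_map_mpoly _ _ _ (val : {rmorphism S -> L})) //; apply: val_inj. Qed.

Lemma sym_lift_eq0 (F : {mpoly S[p]}) : sym_lift F = 0 -> F = 0.
Proof.
rewrite /sym_lift.
have phi_inj : injective phi.
  by apply: raddf_inj => x; apply: lphi_eq0.
rewrite -[X in X = 0](@mmap_map_mpoly _ _ _ phi _ (@mpolyC p L)) // => F0.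
suff F1 : map_mpoly phi F = 0.
  apply/mpolyP => m; apply: phi_inj; rewrite -mcoeff_map_mpoly F1 mcoeff0.
  by rewrite mcoeff0 rmorph0.
apply: (@msubst_affine_inj L p (fun j i => (eminor q i)`_j ^+ p)
  (fun j => phi (frob_series p_pr k j))).
  (* Frobenius commutes with determinants, so the matrix of p-th powers still has a regular
     determinant. *)
  have -> : \matrix_(j, i) ((eminor q i)`_j ^+ p) =
      map_mx (pFrobenius_aut (pchar_mlaurent pk p))
        (\matrix_(j < p, i < p) (eminor q i)`_j) :> 'M[L]_p.
    by apply/matrixP => j i; rewrite !mxE.
  by rewrite det_map_mx; apply/lregX/eminor_det_lreg.
rewrite -[RHS]F0.
apply: eq_mmap => // j.
exact/esym/(deltaS_expand p_pr pk).
Qed.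

Lemma map_val_preim (F : {mpoly L[p]}) : F \is a mpolyOver p powser_last ->
  exists G : {mpoly S[p]}, F = val_mpoly G.
Proof.
move/mpolyOverP => hF.
exists (\sum_(m <- msupp F) (LSeries (hF m)) *: 'X_[m]).
rewrite /val_mpoly (raddf_sum (map_mpoly (val : {rmorphism S -> L}))) [LHS]mpolyE /=.
apply: eq_bigr => m _.
by rewrite [RHS](map_mpolyZ (val : {rmorphism S -> L})) (map_mpolyX (val : {rmorphism S -> L})).
Qed.

Lemma sym_map_inj (F G : {mpoly L[p]}) : F \is a mpolyOver p powser_last ->
  G \is a mpolyOver p powser_last -> sym_map F = sym_map G -> F = G.
Proof.
move=> /map_val_preim[F' ->] /map_val_preim[G' ->].
have sym_lift_inj : injective sym_lift by apply: raddf_inj => x; apply: sym_lift_eq0.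
move=> e.
have e' : sym_lift F' = sym_lift G'.
  apply: etrans (esym (sym_map_val F')) _.
  apply: etrans e _.
  exact: sym_map_val G'.
have e2 := sym_lift_inj _ _ e'.
apply: (congr1 val_mpoly).
exact: e2.
Qed.

End SymInjective.

(** * The preimage of the symmetrized series *)

(** Each subset of j indices avoids exactly n - j indices i. *)
Lemma sum_eminor (A : comNzRingType) n (x : 'I_n -> A) j :
  \sum_i (eminor x i)`_j = (epoly x)`_j *+ (n - j).
Proof.
have e i : (eminor x i)`_j = \sum_(h : {set 'I_n} | (#|h| == j) && (i \notin h))
    \prod_(l in h) x l.
  have -> : eminor x i = epoly (fun l => if l == i then 0 else x l).
    rewrite /epoly (bigD1 i) //= eqxx scale0r addr0 mul1r.
    by apply: eq_bigr => l /negbTE ->.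
  rewrite coef_epoly big_mkcondr; apply: eq_bigr => h _; case: ifP => ih.
    by apply: eq_bigr => l lh; rewrite ifN //; apply: contraNneq ih => <-.
  by move/negbFE: ih => ih; rewrite (bigD1 i) //= eqxx mul0r.
under eq_bigr do rewrite e.
rewrite (exchange_big_dep (fun h : {set 'I_n} => #|h| == j)) /=; last by move=> i h _ /andP[].
rewrite coef_epoly -sumrMnl; apply: eq_bigr => h hj.
rewrite sumr_const; congr (_ *+ _).
have hc : #|~: h| = (n - j)%N.
  by have := cardsC h; rewrite card_ord (eqP hj) => e'; rewrite -[X in (X - _)%N]e' addKn.
by rewrite -hc; apply: eq_card => i; rewrite !inE /in_mem /= hj.
Qed.

(** * Coefficients of V, U and phi^(-1) *)

Section OneVariableCoefficients.
Variables (k : comNzRingType) (p : nat).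
Hypothesis p_gt0 : (0 < p)%N.
Local Notation L1 := (mlaurent k 1).

Lemma mlaurent1_eq (f g : L1) : (forall z, f [ffun=> z] = g [ffun=> z]) -> f = g.
Proof.
move=> fg; apply: mlaurent_eq => d; have -> : d = [ffun=> d ord0] by
  apply/ffunP => i; rewrite ffunE (ord1 i).
exact: fg.
Qed.

Lemma lX_XzM (f : L1) w z : (lX k ^ w * f) [ffun=> z] = f [ffun=> z - w].
Proof.
rewrite lX_Xz [LHS]lmul_monol; congr (f _).
by apply/ffunP => i; rewrite !ffunE.
Qed.

Lemma iter_lV t (f : L1) z : iter t (lV p) f [ffun=> z] =
  if ((p ^ t)%N%:Z %| z)%Z then f [ffun=> (z %/ (p ^ t)%N%:Z)%Z] else 0.
Proof.
elim: t z => [|t IH] z; first by rewrite expn0 dvd1z divz1.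
have p0 : p%:Z != 0 by rewrite eqz_nat -lt0n.
rewrite iterS lVE // expnS PoszM.
have [/dvdzP[w ->]|pz] := boolP (p%:Z %| z)%Z; last first.
  rewrite ifN //; apply: contraNN pz; apply: dvdz_trans; exact: dvdz_mulr.
by rewrite mulzK // IH [w * _]mulrC dvdz_mul2l ?divzMpl //; case: p p_gt0.
Qed.

Lemma iter_lV_shift s (f : L1) (c := iter s.+1 (lV p) f * (lX k ^- p) ^+ (p ^ s)) z :
  c [ffun=> z] = if ((p ^ s.+1)%N%:Z %| z)%Z
    then (lX k ^ (-1) * f) [ffun=> (z %/ (p ^ s.+1)%N%:Z)%Z] else 0.
Proof.
have Q_gt0 : (0 < p ^ s.+1)%N by rewrite expn_gt0 p_gt0.
have Q0 : (p ^ s.+1)%N%:Z != 0 by rewrite eqz_nat -lt0n.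
have -> : c = lX k ^ (- (p ^ s.+1)%N%:Z) * iter s.+1 (lV p) f.
  by rewrite /c mulrC -exprVn -exprM -expnS -exprz_inv.
rewrite !lX_XzM iter_lV !opprK.
have -> : z + (p ^ s.+1)%N%:Z = 1 * (p ^ s.+1)%N%:Z + z by rewrite mul1r addrC.
by rewrite rpredDl ?dvdz_mull // divzMDl // addrC.
Qed.

Lemma lprimE (f : L1) z : lprim p f [ffun=> z] = z%:~R ^+ (p - 2) * f [ffun=> z].
Proof.
rewrite /lprim; elim: (p - 2)%N => [|m IH]; first by rewrite mul1r.
by rewrite iterS lthetaE IH exprS mulrA.
Qed.

End OneVariableCoefficients.

Section LineSubstitution.
Variables (k : comNzRingType) (p : nat) (i : 'I_p).

Definition lline_subst : mlaurent k 1 -> mlaurent k p := lsubst (fun=> lvar k i).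

Lemma lline_subst_zmod : zmod_morphism lline_subst.
Proof.
have c (F : mlaurent k 1) : supp_in (@last_cone 1) F by move=> e _; apply: last_cone1.
by move=> F G; rewrite /lline_subst (lsubstD (lvar_evaluable k i)) ?(lsubstN (lvar_evaluable k i)).
Qed.

Lemma lline_subst_monoid : monoid_morphism lline_subst.
Proof.
have c (F : mlaurent k 1) : supp_in (@last_cone 1) F by move=> e _; apply: last_cone1.
split=> [|F G]; first exact: lsubst1 (lvar_evaluable k i).
by rewrite /lline_subst (lsubstM (lvar_evaluable k i)).
Qed.

HB.instance Definition _ := GRing.isZmodMorphism.Build _ _ lline_subst lline_subst_zmod.
HB.instance Definition _ := GRing.isMonoidMorphism.Build _ _ lline_subst lline_subst_monoid.

End LineSubstitution.

Section Preimage.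
Variables (k : fieldType) (p : nat).
Hypotheses (pk : p \in [pchar k]) (p_odd : odd p).
Let p_pr : prime p := pcharf_prime pk.
Let p_gt0 : (0 < p)%N := prime_gt0 p_pr.
Local Notation L := (mlaurent k p).
Local Notation S := (lseries k p).
Local Notation q := (lvar k (n := p)).
Local Notation phi := (@lphi k p).
Local Notation sig := (@lsig k p p_gt0).

Lemma pchar_mpoly (A : comNzRingType) m : p \in [pchar A] -> p \in [pchar {mpoly A[m]}].
Proof.
by move=> pA; rewrite inE p_pr -(rmorph_nat (@mpolyC m A)) (pcharf0 pA) rmorph0 /=.
Qed.

Definition esym_coef (j : nat) : S :=
  if j is j'.+1 then (if insub j' is Some l then svar k l else 0) else 1.

Lemma esym_coefE (j : 'I_p) : phi (esym_coef j) = (epoly q)`_j.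
Proof.
case: j => [[|j] jp] /=; first by rewrite rmorph1 epoly0.
by rewrite insubT ?(ltnW jp) // => jp'; rewrite lphi_svar -epoly_lesym.
Qed.

Definition minor_sum (j : nat) : S := esym_coef j *+ (p - j).

Lemma minor_sumE (j : 'I_p) : phi (minor_sum j) = \sum_i (eminor q i)`_j.
Proof. by rewrite sum_eminor rmorphMn /= esym_coefE. Qed.

(** This removes phi_0 from the formula: the index 0 gives p = 0, and the others give a multiple of
    some s_j with j < p. *)
Lemma lsig_minor_sum (j : 'I_p) : sig (minor_sum j) = 0.
Proof.
rewrite /minor_sum rmorphMn /=; case: j => [[|j] jp] /=.
  by rewrite rmorph1 subn0 (pcharf0 (pchar_mlaurent pk 1)).
by rewrite insubT ?(ltnW jp) // => jp'; rewrite lsig_svar /= ltn_eqF // mul0rn.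
Qed.

Lemma minor_sum_powser (j : nat) : lval (minor_sum j) \in powser.
Proof.
rewrite -[lval _]/(val (minor_sum j)) rmorphMn rpredMn //; case: j => [|j].
  exact: rpred1.
by rewrite /=; case: insubP => [l _ _|_]; [exact: svar_subproof | exact: rpred0].
Qed.

Lemma frob_series_powser (j : 'I_p) : lval (frob_series p_pr k j) \in powser.
Proof.
rewrite -[lval _]/(val (mev (svar k (p := p)) (frob_poly p_pr j))).
rewrite (rmorph_mev _ (val : {rmorphism S -> L})) /mev /mmap.
apply: rpred_sum => m _; apply: rpredM; first exact: rpred_int.
by apply: rpred_prod => i _; apply: rpredX; apply: svar_subproof.
Qed.

(** s'_j - C_j maps to sum_i M_j(i)^p q_i', whose p^s-th power has the coefficients M_j(i)^(p^(s+1))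
    that [B] is made for. *)
Definition delta_term (B : 'I_p -> S) (s : nat) : {mpoly S[p]} :=
  \sum_j (B j)%:MP * ('X_j - (frob_series p_pr k j)%:MP) ^+ (p ^ s).

Definition sym_preim (B0 : 'I_p -> S) (B : nat -> 'I_p -> S) (n : nat) : {mpoly S[p]} :=
  (\sum_j B0 j * minor_sum j)%:MP + \sum_(s < n) delta_term (B s) s.

Lemma sym_lift_delta_term (B : 'I_p -> S) s :
  sym_lift (delta_term B s) =
  \sum_i (\sum_j phi (B j) * (eminor q i)`_j ^+ (p ^ s.+1))%:MP * 'X_i ^+ (p ^ s).
Proof.
have pL : p \in [pchar {mpoly L[p]}] by apply/pchar_mpoly/pchar_mlaurent.
have liftC (c : S) : sym_lift c%:MP = (phi c)%:MP by rewrite /sym_lift mmapC.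
have liftX j : sym_lift 'X_j = deltaS k j by rewrite /sym_lift mmapX mmap1U.
rewrite /delta_term rmorph_sum /=.
transitivity (\sum_j \sum_i (phi (B j) * (eminor q i)`_j ^+ (p ^ s.+1))%:MP * 'X_i ^+ (p ^ s)
   : {mpoly L[p]}).
  apply: eq_bigr => j _; rewrite rmorphM rmorphXn rmorphB /= !liftC liftX.
  rewrite (deltaS_expand p_pr pk) addrAC subrr add0r expr_sum_pchar // mulr_sumr.
  apply: eq_bigr => i _; rewrite exprMn mulrA; congr (_ * _).
  by rewrite -rmorphXn -rmorphM /= -exprM -expnS.
rewrite exchange_big /=; apply: eq_bigr => i _.
by rewrite rmorph_sum mulr_suml.
Qed.

Variables (phi0 : mlaurent k 1) (ph : nat -> mlaurent k 1) (n : nat).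
Let c s := iter s.+1 (lV p) (ph s) * (lX k ^- p) ^+ (p ^ s).
Let b s := lX k ^ (-1) * ph s.
Let f : {poly mlaurent k 1} := phi0%:P + \sum_(s < n) (c s)%:P * 'X^(p ^ s).

Lemma Sigma_expand : Sigma p f =
  \sum_i ((lline_subst i phi0)%:MP
    + \sum_(s < n) (lline_subst i (c s))%:MP * 'X_i ^+ (p ^ s)) :> {mpoly L[p]}.
Proof.
apply: eq_bigr => i _.
pose h : {rmorphism {poly mlaurent k 1} -> {mpoly L[p]}} :=
  horner_eval 'X_i \o map_poly (@mpolyC p L \o lline_subst i).
have hC a : h a%:P = (lline_subst i a)%:MP.
  by rewrite /h /= map_polyC /horner_eval hornerC.
have hX : h 'X = 'X_i by rewrite /h /= map_polyX /horner_eval hornerX.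
rewrite -[LHS]/(h f) (rmorphD h) (rmorph_sum h) hC; congr (_ + _).
by apply: eq_bigr => s _; rewrite (rmorphM h) (rmorphXn h) hC hX.
Qed.

Variables (B0 : 'I_p -> S) (B : nat -> 'I_p -> S).
Hypothesis B0_line : forall i,
  \sum_(j < p) phi (B0 j) * (eminor q i)`_j = lline_subst i phi0.
Hypothesis B_line : forall s i,
  \sum_(j < p) phi (B s j) * (eminor q i)`_j ^+ (p ^ s.+1) = lline_subst i (c s).

Lemma sym_lift_preim : sym_lift (sym_preim B0 B n) = Sigma p f.
Proof.
rewrite Sigma_expand big_split /= /sym_preim (rmorphD (@sym_lift k p)) /=.
congr (_ + _).
  have -> : sym_lift (\sum_j B0 j * minor_sum j)%:MP =
      (phi (\sum_j B0 j * minor_sum j))%:MP by rewrite /sym_lift mmapC.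
  rewrite -(rmorph_sum (@mpolyC p L)) /=; congr mpolyC.
  rewrite rmorph_sum /=; under [RHS]eq_bigr => i _ do rewrite -B0_line.
  rewrite exchange_big; apply: eq_bigr => j _.
  by rewrite rmorphM /= minor_sumE mulr_sumr.
rewrite [RHS]exchange_big (rmorph_sum (@sym_lift k p)) /=; apply: eq_bigr => s _.
apply: etrans (sym_lift_delta_term (B s) s) _; apply: eq_bigr => i _.
by rewrite B_line.
Qed.

Definition spec_lift : {mpoly S[p]} -> {poly mlaurent k 1} :=
  mmap (@polyC (mlaurent k 1) \o sig) (fun i : 'I_p => if i.+1 == p then 'X else 0).

HB.instance Definition _ := GRing.RMorphism.copy spec_lift
  (mmap (@polyC (mlaurent k 1) \o sig) (fun i : 'I_p => if i.+1 == p then 'X else 0)).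

Lemma specialize_val (F : {mpoly S[p]}) : specialize (val_mpoly F) = spec_lift F.
Proof.
by rewrite /val_mpoly /specialize (@mmap_map_mpoly _ _ _ (val : {rmorphism S -> L})).
Qed.

Hypothesis B_sig : forall s (j : 'I_p) z, sig (B s j) [ffun=> z] =
  if ((p ^ s.+1)%N%:Z %| z)%Z then
    (-1) ^+ j * b s [ffun=> p%:Z * (z %/ (p ^ s.+1)%N%:Z)%Z + j%:Z] else 0.

(** The coordinate p-1 keeps the exponents of q^(-1) phi congruent to -1 mod p, that is, the
    exponents of phi divisible by p. Its sign (-1)^(p-1) is 1. *)
Lemma lsig_last s : sig (B s (olast p_gt0)) =
  iter s.+1 (lV p) (lU p (ph s)) * (lX k ^- p) ^+ (p ^ s).
Proof.
apply: mlaurent1_eq => z; rewrite B_sig iter_lV_shift // !lX_XzM lUE // !opprK.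
case: ifP => // _.
have -> : (-1) ^+ (olast p_gt0) = 1 :> k.
  by rewrite -signr_odd /=; move: p_odd p_gt0; case: (p) => //= m /negbTE ->.
rewrite mul1r; congr (ph s _); apply/ffunP => i; rewrite !ffunE /=.
by rewrite mulrDl mul1r mulrC -addrA; congr (_ + _); move: p_gt0; clear; lia.
Qed.

Lemma natrX_pchar (A : comNzRingType) (m s : nat) : p \in [pchar A] ->
  m%:R ^+ (p ^ s) = m%:R :> A.
Proof.
move=> pA; elim: s => [|s IH]; first by rewrite expr1.
by rewrite expnSr exprM IH -(pFrobenius_autE pA) pFrobenius_aut_nat.
Qed.

Lemma intr_fermat (z : int) : ~~ (p%:Z %| z)%Z -> z%:~R ^+ p.-1 = 1 :> k.
Proof.
move=> pz; have zF : z%:~R != 0 :> k.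
  apply: contraNN pz; rewrite dvdzE /=; case: z => m; rewrite ?NegzE ?rmorphN ?oppr_eq0 /=.
    by rewrite -pmulrn -(dvdn_pcharf pk).
  by rewrite -pmulrn -(dvdn_pcharf pk).
apply: (mulfI zF); rewrite -exprS prednK // mulr1.
by rewrite -(pFrobenius_autE pk) rmorph_int.
Qed.

(** At the exponent p^s w, the j-th summand is nonzero only if w is congruent to j+1 mod p; it is
    then (-1)^j phi_w times the constant of C_j. So at most one j counts. *)
Lemma lsig_defect_sum s :
  \sum_(j < p) sig (B s j) * sig (frob_series p_pr k j) ^+ (p ^ s) =
  iter s (lV p) (lprim p (ph s)).
Proof.
have P_gt0 : (0 < p ^ s)%N by rewrite expn_gt0 p_gt0.
have P0 : (p ^ s)%N%:Z != 0 by rewrite eqz_nat -lt0n.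
apply: mlaurent1_eq => z; rewrite sumE iter_lV // lprimE.
have term (j : 'I_p) : (sig (B s j) * sig (frob_series p_pr k j) ^+ (p ^ s)) [ffun=> z] =
    sig (B s j) [ffun=> z - ((p ^ s) * j.+1)%N%:Z] *+ frob_const p j.
  rewrite lsig_frob_series // -mulr_natr exprMn natrX_pchar ?pchar_mlaurent //.
  by rewrite mulrA mulr_natr mulrnE mulrC -exprM mulnC exprnP lX_XzM.
under eq_bigr => j _ do rewrite term B_sig expnS [(p * _)%N]mulnC.
have [/dvdzP[w ->]|Pz] := boolP ((p ^ s)%N%:Z %| z)%Z; last first.
  rewrite big1 // => j _; case: ifP => [h|]; last by rewrite mul0rn.
  case/negP: Pz; rewrite -(subrK ((p ^ s) * j.+1)%N%:Z z) rpredD //.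
    by apply: dvdz_trans h; rewrite PoszM dvdz_mulr.
  by rewrite PoszM dvdz_mulr.
rewrite mulzK //.
have term2 (j : 'I_p) :
  (if ((p ^ s * p)%N%:Z %| w * (p ^ s)%N%:Z - (p ^ s * j.+1)%N%:Z)%Z
    then (-1) ^+ j * b s [ffun=> p%:Z * ((w * (p ^ s)%N%:Z - (p ^ s * j.+1)%N%:Z) %/ (p ^ s * p)%N%:Z)%Z + j%:Z]
    else 0) *+ frob_const p j =
  if (p%:Z %| w - j.+1%:Z)%Z then (-1) ^+ j * ph s [ffun=> w] *+ frob_const p j else 0.
  have -> : w * (p ^ s)%N%:Z - (p ^ s * j.+1)%N%:Z = (p ^ s)%N%:Z * (w - j.+1%:Z).
    by rewrite mulrBr -PoszM mulrC.
  rewrite PoszM dvdz_mul2l // divzMpl; last by rewrite ltz_nat.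
  case: ifP => [h|_]; last by rewrite mul0rn.
  rewrite lX_XzM [p%:Z * _]mulrC divzK //; congr (_ * ph s _ *+ _).
  by apply/ffunP => i; rewrite !ffunE; clear; lia.
under eq_bigr => j _ do rewrite term2.
have p2 : (2 < p)%N by move: p_pr p_odd; case: (p) => [|[|[|]]].
(* If p divides w, only j+1 = p remains; its constant is 0, in agreement with w^(p-2) = 0. *)
have [pw|pw] := boolP (p%:Z %| w)%Z.
  have -> : w%:~R = 0 :> k.
    by case/dvdzP: pw => l ->; rewrite rmorphM /= [X in _ * X](pcharf0 pk) mulr0.
  rewrite expr0n subn_eq0 leqNgt p2 mul0r big1 // => j _; case: ifP => // h.
  have pj : (p %| j.+1)%N.
    by rewrite -[(_ %| _)%N]/(p%:Z %| j.+1%:Z)%Z -(subKr w j.+1%:Z) rpredB.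
  have jp : j.+1 == p by rewrite eqn_leq ltn_ord dvdn_leq.
  by rewrite /frob_const jp mulr0n.
have p0 : p%:Z != 0 by rewrite eqz_nat -lt0n.
have [r hr] : exists r : nat, (w %% p%:Z)%Z = r%:Z.
  by exists (absz (w %% p%:Z)%Z); rewrite gez0_abs // modz_ge0.
have rp : (r < p)%N by rewrite -ltz_nat -hr ltz_pmod.
have r0 : (0 < r)%N.
  by rewrite lt0n; apply: contraNneq pw => r0; apply/dvdz_mod0P; rewrite hr r0.
have wE : w = (w %/ p%:Z)%Z * p%:Z + r%:Z by rewrite -hr -divz_eq.
have jp0 : (r.-1 < p)%N by rewrite prednK // ltnW.
pose j0 := Ordinal jp0; have j0E : j0.+1 = r by rewrite /= prednK.
have dvdj (j : 'I_p) : (p%:Z %| w - j.+1%:Z)%Z = (j == j0).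
  rewrite wE -addrA rpredDl ?dvdz_mull //; apply/idP/eqP => [/dvdzP[l hl]|->]; last first.
    by rewrite j0E subrr dvdz0.
  apply: val_inj; apply: succn_inj; rewrite j0E /=; have := ltn_ord j.
  move: (nat_of_ord j) hl => m hl.
  have [l0|[l1|l1]] : l = 0 \/ (1 <= l \/ l <= -1) by clear; lia.
  - by move: hl; rewrite l0 mul0r; clear; lia.
  - have := ler_wpM2r (isT : 0 <= p%:Z) l1; move: hl rp; clear; lia.
  - have := ler_wpM2r (isT : 0 <= p%:Z) l1; move: hl r0; clear; lia.
rewrite (bigD1 j0) // dvdj eqxx big1 => [|j jj]; last by rewrite dvdj (negbTE jj).
rewrite [LHS]addr0 -mulrnAl; congr (_ * _).
have wk : w%:~R = j0.+1%:R :> k.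
  rewrite j0E [in LHS]wE rmorphD rmorphM /= [X in _ * X](pcharf0 pk) mulr0 add0r.
  by rewrite -pmulrn.
have jp : j0.+1 != p by rewrite j0E ltn_eqF.
have hc := frob_const_pchar p_pr pk jp.
have := intr_fermat pw; rewrite wk => f1.
have w0 : j0.+1%:R != 0 :> k.
  by apply/eqP => e; move/eqP: f1; rewrite e expr0n -subn1 subn_eq0 leqNgt ltnW // eq_sym oner_eq0.
(* After multiplication by w, both factors of phi_w are 1: w^(p-1) by Fermat, and (-1)^j (j+1) times
   the constant, which is (-1)^(2j). *)
apply: (mulfI w0); rewrite -exprS.
have -> : (p - 2).+1 = p.-1 by move: p2; clear; lia.
by rewrite f1 -[(-1) ^+ r.-1 *+ _]mulr_natr mulrCA hc -expr2 sqrr_sign.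
Qed.

Lemma spec_lift_preim : spec_lift (sym_preim B0 B n) =
  - \sum_(s < n) (iter s (lV p) (lprim p (ph s)))%:P
  + \sum_(s < n) (iter s.+1 (lV p) (lU p (ph s)) * (lX k ^- p) ^+ (p ^ s))%:P * 'X^(p ^ s).
Proof.
have specC a : spec_lift a%:MP = (sig a)%:P by rewrite /spec_lift mmapC.
have specX j : spec_lift 'X_j = if j.+1 == p then 'X else 0.
  by rewrite /spec_lift mmapX mmap1U.
have specD (a a' : {mpoly S[p]}) : spec_lift (a + a') = spec_lift a + spec_lift a'.
  exact: rmorphD.
have specB (a a' : {mpoly S[p]}) : spec_lift (a - a') = spec_lift a - spec_lift a'.
  exact: rmorphB.
have specM (a a' : {mpoly S[p]}) : spec_lift (a * a') = spec_lift a * spec_lift a'.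
  exact: rmorphM.
have specXn (a : {mpoly S[p]}) m : spec_lift (a ^+ m) = spec_lift a ^+ m.
  exact: rmorphXn.
have spec_sum m (a : 'I_m -> {mpoly S[p]}) :
    spec_lift (\sum_i a i) = \sum_i spec_lift (a i).
  exact: rmorph_sum.
rewrite /sym_preim specD specC rmorph_sum big1 => [|j _]; last first.
  by rewrite rmorphM /= lsig_minor_sum mulr0.
rewrite polyC0 add0r spec_sum addrC -sumrB; apply: eq_bigr => s _.
rewrite /delta_term spec_sum.
have term (j : 'I_p) : spec_lift ((B s j)%:MP * ('X_j - (frob_series p_pr k j)%:MP) ^+ (p ^ s))
  = (if j == olast p_gt0 then (sig (B s j))%:P * 'X^(p ^ s) else 0)
    - (sig (B s j) * sig (frob_series p_pr k j) ^+ (p ^ s))%:P.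
  rewrite specM specXn specB !specC specX.
  rewrite (eq_olast p_gt0); case: eqP => [->|_].
    (* At the last index C_j specializes to 0 and s'_p to q'. *)
    rewrite lsig_frob_series // /frob_const olastE eqxx mulr0n polyC0 subr0.
    by rewrite expr0n expn_eq0 gtn_eqF // mulr0 polyC0 subr0.
  (* At the others s'_j specializes to 0. As p^s is odd, the power of - C_j produces the minus sign
     of the formula. *)
  rewrite !sub0r exprNn -signr_odd oddX p_odd orbT expr1 mulN1r mulrN.
  by rewrite polyCM polyC_exp.
rewrite (eq_bigr _ (fun j _ => term j)) sumrB -(rmorph_sum (@polyC _)) /= lsig_defect_sum.
by rewrite -big_mkcond big_pred1_eq lsig_last.
Qed.

End Preimage.

(** * Integrality and the Taylor case *)

Section Powser.
Variables (k : fieldType) (p : nat).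
Hypothesis p_pr : prime p.
Let p_gt0 : (0 < p)%N := prime_gt0 p_pr.

Lemma powser1P (F : mlaurent k 1) :
  (F \in powser) <-> (forall z, z < 0 -> F [ffun=> z] = 0).
Proof.
split=> [/powserP h z z0|h].
  apply/eqP; apply: contraT => /h/(_ ord0); rewrite ffunE.
  by rewrite leNgt z0.
apply/powserP => e he i; rewrite (ord1 i) leNgt; apply: contraNN he => /h h0.
rewrite -[X in _ == X]h0; apply/eqP; congr (F _); apply/ffunP => l.
by rewrite ffunE (ord1 l).
Qed.

Lemma shift_powser (F : mlaurent k 1) :
  (lX k ^ (-1) * F \in powser) <-> (exists2 g, g \in powser & F = lX k * g).
Proof.
have XV : lX k * lX k ^ (-1) = 1.
  by rewrite -{1}[lX k]expr1z -exprzDr ?lmono_unit.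
split=> [h|[g hg ->]]; first by exists (lX k ^ (-1) * F); rewrite // mulrA XV mul1r.
by rewrite mulrA [_ * lX k]mulrC XV mul1r.
Qed.

Lemma iter_lV_powser (b c : mlaurent k 1) (Q : nat) : (0 < Q)%N ->
    (forall z, c [ffun=> z] =
      if (Q%:Z %| z)%Z then b [ffun=> (z %/ Q%:Z)%Z] else 0) ->
  (c \in powser) <-> (b \in powser).
Proof.
move=> Q_gt0 cE; have Q0 : Q%:Z != 0 by rewrite eqz_nat -lt0n.
rewrite !powser1P; split=> h z z0.
  have := cE (z * Q%:Z); rewrite dvdz_mull // mulzK // => <-; apply: h.
  by rewrite pmulr_llt0.
rewrite cE; case: ifP => // /divzK zQ; apply: h.
by rewrite -(pmulr_llt0 _ (Q_gt0 : 0 < Q%:Z)) zQ.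
Qed.

Variables (phi0 : mlaurent k 1) (c : nat -> mlaurent k 1) (n : nat).

Lemma coef_poly_pexp m : (phi0%:P + \sum_(s < n) (c s)%:P * 'X^(p ^ s))`_m =
  (if m == 0 then phi0 else 0) + \sum_(s < n) (if (m == p ^ s)%N then c s else 0).
Proof.
rewrite coefD coefC coef_sum; congr (_ + _); apply: eq_bigr => s _.
by rewrite coefCM coefXn; case: eqP; rewrite ?mulr1 ?mulr0.
Qed.

(** The exponents 0 and p^s are pairwise distinct, so no two terms share a coefficient. *)
Lemma polyOver_pexp : phi0%:P + \sum_(s < n) (c s)%:P * 'X^(p ^ s) \is a polyOver powser <->
  phi0 \in powser /\ forall s, (s < n)%N -> c s \in powser.
Proof.
split=> [/polyOverP h|[h0 hc]].
  have := h 0; rewrite coef_poly_pexp eqxx big1 ?addr0 => [h0|s _]; last first.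
    by rewrite eq_sym expn_eq0 gtn_eqF.
  split=> // s sn; have := h (p ^ s)%N.
  rewrite coef_poly_pexp expn_eq0 gtn_eqF // add0r (bigD1 (Ordinal sn)) //= eqxx.
  rewrite big1 ?addr0 // => l ls; rewrite eqn_exp2l ?prime_gt1 // ifN //.
  by apply: contraNneq ls => e; apply/eqP/val_inj.
rewrite rpredD ?polyOverC // rpred_sum // => s _.
by rewrite rpredM ?rpredX ?polyOverX // polyOverC hc.
Qed.

End Powser.

Section Taylor.
Variables (k : fieldType) (p : nat).
Hypotheses (pk : p \in [pchar k]).
Local Notation S := (lseries k p).

Lemma val_mpoly_last (F : {mpoly S[p]}) : val_mpoly F \is a mpolyOver p powser_last.
Proof.
apply/mpolyOverP => m; rewrite /val_mpoly mcoeff_map_mpoly.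
exact: valP.
Qed.

Lemma sym_preim_powser (B0 : 'I_p -> S) (B : nat -> 'I_p -> S) n :
    (forall j, lval (B0 j) \in powser) ->
    (forall s j, (s < n)%N -> lval (B s j) \in powser) ->
  val_mpoly (sym_preim pk B0 B n) \is a mpolyOver p powser.
Proof.
move=> h0 hB; pose v : {rmorphism {mpoly S[p]} -> {mpoly mlaurent k p[p]}} :=
  map_mpoly (val : {rmorphism S -> _}).
have vC a : v a%:MP = (lval a)%:MP by exact: (@map_mpolyC p _ _ (val : {rmorphism S -> mlaurent k p}) a).
have vX j : v 'X_j = 'X_j by exact: (map_mpolyX (val : {rmorphism S -> mlaurent k p})).
rewrite -[val_mpoly _]/(v _) /sym_preim (rmorphD v) (rmorph_sum v) vC.
rewrite rpredD // ?mpolyOverC.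
  rewrite -[lval _]/(val (\sum_j B0 j * minor_sum k p j)) rmorph_sum rpred_sum // => j _.
  by rewrite rmorphM rpredM ?h0 ?minor_sum_powser.
rewrite rpred_sum // => s _; rewrite (rmorph_sum v) rpred_sum // => j _.
rewrite (rmorphM v) (rmorphXn v) (rmorphB v) !vC vX rpredM ?mpolyOverC ?hB // rpredX //.
by rewrite rpredB ?mpolyOverX ?mpolyOverC ?frob_series_powser.
Qed.

End Taylor.

Theorem theorem4p2 (p : nat) (k : closedFieldType)
    (iota : {rmorphism 'F_p -> k}) (p_prime : prime p) (p_ge5 : (5 <= p)%N)
    (k_alg : forall x : k, algebraicOver iota x)
    (phi0 : mlaurent k 1) (phi : nat -> mlaurent k 1) (n : nat)
    (phi_fin : forall s : nat, (n <= s)%N -> phi s = 0) :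
  let f : {poly mlaurent k 1} :=
    phi0%:P + \sum_(s < n) (iter s.+1 (lV p) (phi s))%:P
                             * ((lX k ^- p)%:P * 'X) ^+ (p ^ s) in
  [/\ laurent_sym p f,
      pU p f =
        - \sum_(s < n) (iter s (lV p) (lprim p (phi s)))%:P
        + \sum_(s < n) (iter s.+1 (lV p) (lU p (phi s)))%:P
                         * ((lX k ^- p)%:P * 'X) ^+ (p ^ s),
      f \is a polyOver powser <->
        phi0 \in powser /\
        (forall s : nat, exists2 g, g \in powser & phi s = lX k * g)
    & f \is a polyOver powser -> taylor_sym p f].
Proof.
move=> f; have pk : p \in [pchar k] by apply: (rmorph_pchar iota); apply: pchar_Fp.
have p_odd : odd p by case: (even_prime p_prime) p_ge5 => // ->.
have p_gt0 := prime_gt0 p_prime.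
have termE (a : mlaurent k 1) s : a%:P * ((lX k ^- p)%:P * 'X) ^+ (p ^ s) =
    (a * (lX k ^- p) ^+ (p ^ s))%:P * 'X^(p ^ s).
  by rewrite exprMn -polyC_exp mulrA -polyCM.
pose c s := iter s.+1 (lV p) (phi s) * (lX k ^- p) ^+ (p ^ s).
pose b s := lX k ^ (-1) * phi s.
have fE : f = phi0%:P + \sum_(s < n) (c s)%:P * 'X^(p ^ s).
  by congr (_ + _); apply: eq_bigr => s _; rewrite termE.
have cE s z := iter_lV_shift p_gt0 s (phi s) z.
have c_powser s : (c s \in powser) <-> (b s \in powser).
  by apply: iter_lV_powser (cE s); rewrite expn_gt0 p_gt0.
(* For t = 0, Q = 1 and [A] is g itself. *)
have [|B0 [B0_line _ B0_pow]] := @glue_family k p pk p_odd 0 phi0 phi0.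
  by move=> z; rewrite expn0 dvd1z divz1.
(* Here t = s + 1 and g = q^(-1) phi_s. *)
have [B hB] := choice (fun s => glue_family pk p_odd (cE s)).
pose G := sym_preim pk B0 B n.
have symG : sym_map (val_mpoly G) = Sigma p f.
  apply: etrans (sym_map_val G) _; rewrite fE.
  apply: sym_lift_preim => [i|s i]; last by have [h _ _] := hB s; apply: h.
  by rewrite -[RHS]B0_line; apply: eq_bigr => j _; rewrite expn0 expr1.
have GP := val_mpoly_last G.
have iffP : f \is a polyOver powser <->
    phi0 \in powser /\ (forall s : nat, exists2 g, g \in powser & phi s = lX k * g).
  rewrite fE polyOver_pexp //; split=> -[h0 hc]; split=> // s.
    have [sn|/phi_fin ->] := ltnP s n; last by exists 0; rewrite ?rpred0 ?mulr0.
    by apply: (proj1 (shift_powser (phi s))); apply: (proj1 (c_powser s)); apply: hc.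
  by move=> sn; apply: (proj2 (c_powser s)); apply: (proj2 (shift_powser (phi s))).
split=> //.
- by exists (val_mpoly G).
- have preimE : Sigma_preim p f = val_mpoly G.
    have [] := xgetPex 0 (P := [set F | F \is a mpolyOver p powser_last /\
        sym_map F = Sigma p f]%classic) (ex_intro _ _ (conj GP symG)).
    move=> FP symF; apply: (sym_map_inj p_prime pk FP GP).
    exact: etrans symF (esym symG).
  rewrite /pU preimE; apply: etrans (specialize_val pk G) _.
  have B_sig s (j : 'I_p) z := let: And3 _ h _ := hB s in h j z.
  apply: etrans (@spec_lift_preim k p pk p_odd phi n B0 B B_sig) _.
  by congr (_ + _); apply: eq_bigr => s _; rewrite termE.
move=> fP; split=> //; exists (val_mpoly G) => //.
have [phi0P hc] : phi0 \in powser /\ forall s, (s < n)%N -> c s \in powser.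
  by apply/(polyOver_pexp p_prime); rewrite -fE.
apply: sym_preim_powser => [j|s j sn].
  by apply: B0_pow; apply: (proj1 (powser1P phi0)).
have [_ _ h] := hB s; apply: h; apply: (proj1 (powser1P (b s))).
by apply: (proj1 (c_powser s)); apply: hc.
Qed.
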